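(* Suppose $X$ is a metric space, $f:X\to\mathbb{R}_\infty$, $x\in[f>0]$, and $\tau>0$. Consider the inequality $$\tau d(x,[f\le0])\le f(x).\qquad( * )$$ (i) Let $X$ be complete, $f$ be lower semicontinuous, and $\alpha\in]0,1]$. Inequality $( * )$ holds, provided that one of the following conditions is satisfied: (a) $|\breve\nabla f|\in|\mathfrak{D}f|^\dag$ and $\alpha|\breve\nabla f|(u)\ge\tau$ for all $u\in X$ satisfying (1) $f(u)\le f(x)$, (2) $d(u,x)<\alpha d(x,[f\le0])$, (3) $\alpha f(u)<\tau d(u,[f\le0])$, (4) $f(u)<\tau d(x,[f\le0])$; (b) $X$ is Asplund and there exists a $\mu>f(x)$ such that $\alpha|\partial^Ff|(u)\ge\tau$ for all $u\in X$ satisfying $f(u)<\mu$ and conditions (2), (3) and (4). (ii) If $( * )$ holds, then $|\nabla f|^\diamond(x)\ge\tau$. (iii) Let $X$ be a normed space, and $f$ be convex. If $( * )$ holds, then $|\partial f|(x)\ge\tau$.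
   Context: Notation: $\mathbb{R}_\infty=\mathbb{R}\cup\{+\infty\}$, $a_+=\max\{a,0\}$; $d(x,\Omega)=\inf_{u\in\Omega}d(x,u)$ with $d(x,\emptyset)=+\infty$. For $f:X\to\mathbb{R}_\infty$: $\mathrm{dom} f=\{x\mid f(x)<+\infty\}$, $[f\le0]=\{x\mid f(x)\le0\}$, $[f>0]=\{x\mid f(x)>0\}$. Normed spaces are metric spaces with the distance induced by the norm; $X^*$ is the dual. Slopes: for $x\in\mathrm{dom} f$, the slope is $|\nabla f|(x)=\limsup_{u\to x,\,u\ne x}\frac{[f(x)-f(u)]_+}{d(u,x)}$ and the nonlocal slope is $|\nabla f|^\diamond(x)=\sup_{u\ne x}\frac{[f(x)-f_+(u)]_+}{d(u,x)}$, where $f_+(u)=\max\{f(u),0\}$; both are $+\infty$ for $x\notin\mathrm{dom} f$. Subdifferentials in a normed space, for $x\in\mathrm{dom} f$ (all are empty for $x\notin\mathrm{dom} f$): Fréchet, $\partial^Ff(x)=\{x^*\in X^*\mid\liminf_{u\to x,u\neq x}\frac{f(u)-f(x)-\langle x^*,u-x\rangle}{\|u-x\|}\ge0\}$; Clarke, $\partial^Cf(x)=\{x^*\in X^*\mid\langle x^*,z\rangle\le f^\circ(x;z)\ \forall z\in X\}$, where $f^\circ(x;z)=\lim_{\varepsilon\downarrow0}\limsup_{(u,a)\to(x,f(x)),\,f(u)\le a,\,t\downarrow0}\inf_{\|z'-z\|<\varepsilon}\frac{f(u+tz')-a}{t}$. For convex $f$ both coincide with the convex subdifferential $\partial f(x)=\{x^*\in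 X^*\mid f(u)-f(x)-\langle x^*,u-x\rangle\ge0\ \forall u\in X\}$. Subdifferential slopes: $|\partial^Ff|(x)=d(0,\partial^Ff(x))$, $|\partial^Cf|(x)=d(0,\partial^Cf(x))$, $|\partial f|(x)=d(0,\partial f(x))$ (in the dual norm). Collection of slope operators: $|\mathfrak{D}f|^\dag$ contains $|\nabla f|^\diamond$ and $|\nabla f|$; if $X$ is a Banach space it also contains $|\partial^Cf|$. An Asplund space is a Banach space in which every separable subspace has separable dual. *)

(* Defs.v *)
From HB Require Import structures.
From mathcomp Require Import all_boot all_order all_algebra.
From mathcomp Require Import all_classical all_reals all_analysis.

Set Implicit Arguments.
Unset Strict Implicit.
Unset Printing Implicit Defensive.

Import Order.TTheory GRing.Theory Num.Theory.
Import numFieldNormedType.Exports.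

Local Open Scope classical_set_scope.
Local Open Scope ring_scope.

(* An alias of V, carrying the metric induced by the norm: the library does
   not make normed modules instances of metricType. *)
Definition normed_metric (R : realType) (V : normedModType R) : Type := V.

Section normed_metric.
Context (R : realType) (V : normedModType R).

HB.instance Definition _ := NormedModule.on (normed_metric V).

Definition norm_dist (x y : normed_metric V) : R := `|x - y|.

Let dist_ge0 x y : 0 <= norm_dist x y.
Proof. exact: normr_ge0. Qed.

Let dist_positivity x y : norm_dist x y = 0 -> x = y.
Proof. by move/normr0_eq0/subr0_eq. Qed.

Let ballEdist x d : ball x d = [set y | norm_dist x y < d].
Proof. by rewrite -ball_normE. Qed.

HB.instance Definition _ :=
  PseudoMetric_isMetric.Build R (normed_metric V)
    dist_ge0 dist_positivity ballEdist.

End normed_metric.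

Local Open Scope ereal_scope.

Section metric.
Context (R : realType) (X : metricType R).
Implicit Types (f : X -> \bar R) (x u : X) (A : set X).

(* The axiom of completeType, without its pointedness requirement. *)
Definition complete_metric : Prop :=
  forall F : set_system X, ProperFilter F -> cauchy F -> exists l : X, F --> l.

Definition dist_set x A : \bar R := ereal_inf [set (mdist x u)%:E | u in A].

Definition sublevel0 f : set X := [set u | f u <= 0].

Definition error_bound f (tau : R) x : Prop :=
  tau%:E * dist_set x (sublevel0 f) <= f x.

(* In the two slopes, the outer [maxe 0] gives the value 0 to a supremum over
   the empty set (isolated point, resp. one-point space), where ereal_sup
   would give -oo. *)
Definition slope f x : \bar R :=
  if f x < +oo then
    maxe 0 (limf_esup
      (fun u => maxe 0 (f x - f u) * ((mdist u x)^-1)%:E) x^')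
  else +oo.

Definition nonlocal_slope f x : \bar R :=
  if f x < +oo then
    maxe 0 (ereal_sup
      [set maxe 0 (f x - maxe (f u) 0) * ((mdist u x)^-1)%:E
        | u in [set u | u != x]])
  else +oo.

Definition metric_slopes f : set (X -> \bar R) :=
  [set nonlocal_slope f; slope f].

End metric.

Section normed.
Context (R : realType) (X : normedModType R).
Implicit Types (f : X -> \bar R) (x z : X).

(* The norm of the restriction of p to the subspace Y; the norm of X^* is the
   case Y = setT. *)
Definition dual_norm_on (Y : set X) (p : X -> R) : \bar R :=
  ereal_sup [set `|p z|%:E | z in [set z | Y z /\ (`|z| <= 1)%R]].

Definition dist0_dual (A : set {linear X -> R^o}) : \bar R :=
  ereal_inf [set dual_norm_on setT (p : X -> R) | p in A].

Definition frechet_subdiff f x : set {linear X -> R^o} :=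
  [set p : {linear X -> R^o} | [/\ continuous p, f x < +oo &
    0 <= limf_einf
      (fun u => (f u - f x - (p (u - x)%R : R)%:E) * (`|u - x|^-1)%:E) x^']].

(* The points ((u, a), t) tend to ((x, f x), 0) with f u <= a and t > 0. *)
Definition clarke_filter f x : set_system ((X * R) * R) :=
  within [set q | f q.1.1 <= q.1.2%:E]
    (filter_prod (nbhs (x, fine (f x))) (0 : R)^'+).

Definition clarke_deriv f x z : \bar R :=
  lim ((fun eps : R => limf_esup
    (fun q : (X * R) * R =>
      ereal_inf [set (f (q.1.1 + q.2 *: z')%R - q.1.2%:E) * (q.2^-1)%:E
                  | z' in [set z' | (`|z' - z| < eps)%R]])
    (clarke_filter f x)) eps @[eps --> (0 : R)^'+]).

Definition clarke_subdiff f x : set {linear X -> R^o} :=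
  [set p : {linear X -> R^o} | [/\ continuous p, f x < +oo &
    forall z, (p z : R)%:E <= clarke_deriv f x z]].

Definition convex_subdiff f x : set {linear X -> R^o} :=
  [set p : {linear X -> R^o} | [/\ continuous p, f x < +oo &
    forall u, 0 <= f u - f x - (p (u - x)%R : R)%:E]].

Definition frechet_slope f x : \bar R := dist0_dual (frechet_subdiff f x).

Definition clarke_slope f x : \bar R := dist0_dual (clarke_subdiff f x).

Definition convex_subdiff_slope f x : \bar R :=
  dist0_dual (convex_subdiff f x).

Definition convex_efun f : Prop :=
  forall (u v : X) (t : R), (0 < t < 1)%R ->
    f (t *: u + (1 - t) *: v)%R <= t%:E * f u + (1 - t)%:E * f v.

Definition linear_subspace (Y : set X) : Prop :=
  Y 0%R /\ forall (a : R) u v, Y u -> Y v -> Y (a *: u + v)%R.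

Definition separable_set (Y : set X) : Prop :=
  exists D : set X, [/\ countable D, D `<=` Y & Y `<=` closure D].

(* The dual of a subspace Y: functionals on Y are represented by functions on
   X, of which only the values on Y matter. *)
Definition dual_on (Y : set X) : set (X -> R) :=
  [set p | (forall (a : R) u v, Y u -> Y v ->
              p (a *: u + v)%R = (a * p u + p v)%R)
           /\ {within Y, continuous p}].

Definition separable_dual_on (Y : set X) : Prop :=
  exists D : set (X -> R), [/\ countable D, D `<=` dual_on Y &
    forall p, dual_on Y p -> forall e : R, (0 < e)%R ->
      exists2 q, D q & dual_norm_on Y (fun z => p z - q z)%R < e%:E].

End normed.

Definition asplund (R : realType) (X : completeNormedModType R) : Prop :=
  forall Y : set X,
    linear_subspace Y -> separable_set Y -> separable_dual_on Y.

Definition banach_slopes (R : realType) (X : completeNormedModType R)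
    (f : X -> \bar R) : set (X -> \bar R) :=
  @metric_slopes R (normed_metric X) f `|` [set clarke_slope f].

(* Main.v *)
Require Import Defs.
From HB Require Import structures.
From mathcomp Require Import all_boot all_order all_algebra.
From mathcomp Require Import all_classical all_reals all_analysis.
From mathcomp Require Import zify ring lra.

(** Let S be the sublevel set [f <= 0] and let f_+ be the maximum of f and 0.

    Sufficient conditions.  Suppose that f x < tau d(x, S).  The variational
    principle of Ekeland, applied to f_+, yields a point u with f u <= f x,
    closer to x than alpha d(x, S), which minimizes v |-> f_+ v + c d(u, v)
    for some c with alpha c < tau ([error_bound_failure]).  Such a u lies
    outside S, and comparing it with the points of S shows that
    alpha f u <= alpha c d(u, S) < tau d(u, S); thus u satisfies all the
    conditions under which a slope at least tau / alpha is assumed, and a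
    contradiction arises as soon as the slope at u is shown to be at most c.
    - For the slope and the nonlocal slope this is read off the minimality.
    - For the Clarke slope, the pairs (z, r) such that r majorizes the
      generalized derivative of f at u in the direction z generate a convex
      cone, and minimality says that - c |z| <= r on it.  A linear functional
      separating this cone from the graph of - c |.| is a Clarke subgradient
      of norm at most c ([clarke_subgradient_of_min]).
    - Frechet subgradients may fail to exist at u.  In an Asplund space they
      exist, with norm at most any prescribed c' > c, at points arbitrarily
      close to u with values arbitrarily close to f u ([asplund_fuzzy]); since
      all the conditions imposed on u are open, this is enough.

    Fuzzy minimality in Asplund spaces.  Three constructions are combined.
    - Separable reduction ([separable_reduction]): the existence of a Frechet
      subgradient of norm at most c' at a point is equivalent, by
      Hahn-Banach, to inequalities that each involve finitely many points of
      the space.  A countable set that contains, for every rational instance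
      of such an inequality which fails, a witness of the failure, spans a
      separable subspace Y with the property that subgradients relative to Y
      yield subgradients relative to the whole space.
    - Smooth approximation of the norm ([smooth_norm_exists]): as Y has a
      separable dual, choose q_n dense in the dual ball.  The supremum over
      the dual ball of p z - eta Psi p, where Psi p is the weighted sum of the
      squares of the distances from p to the q_n, differs from |z| by O(eta).
      The uniform convexity of squares forces maximizing p to converge in
      norm, which makes the supremum Frechet superdifferentiable along Y
      everywhere.
    - A smooth variational principle ([perturbed_minimum]): a lower
      semicontinuous function bounded below attains its minimum after the
      addition of a small combination of translates of such approximate
      norms.  At the minimizer, minus a superdifferential of the added
      terms is a Frechet subgradient of f relative to Y.
    With the distance itself as the approximate norm, the same principle
    gives the variational principle of Ekeland used above.

    Necessary conditions.  If tau d(x, S) <= f x, a number n > 0 such that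
    f x <= n d(x, v) for all v in S is at least tau ([error_bound_rate]).
    Any n exceeding the nonlocal slope, or the norm of a convex subgradient,
    has this property. *)

Set Implicit Arguments.
Unset Strict Implicit.
Unset Printing Implicit Defensive.

Import Order.TTheory GRing.Theory Num.Theory.
Import numFieldNormedType.Exports.

Local Open Scope classical_set_scope.
Local Open Scope ring_scope.

(** * Hahn-Banach separation by maximal convex cones *)

Section hahn_banach.
Context (R : realType) (X : normedModType R).
Implicit Types (E : set (X * R)) (c : R).

(** Epigraphs of sublinear functionals between - c |.| and c |.| have these
properties, and among the sets that have them the maximal ones are the
epigraphs of linear functionals. *)
Definition epi_cone c E : Prop :=
  [/\ forall a b, E a -> E b -> E (a.1 + b.1, a.2 + b.2),
      forall (t : R) a, 0 < t -> E a -> E (t *: a.1, t * a.2),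
      forall z s, c * `|z| <= s -> E (z, s) &
      forall s, E (0, s) -> 0 <= s].

(** The hypothesis excludes the only way in which adjoining the ray through
(z, s) can destroy the last clause of [epi_cone]. *)
Lemma epi_cone_adjoin c E z s : epi_cone c E ->
  (forall w r (t : R), 0 < t -> E (w, r) -> w + t *: z = 0 -> 0 <= r + t * s) ->
  epi_cone c [set a | exists t : R, 0 <= t /\
    E (a.1 - t *: z, a.2 - t * s)].
Proof.
move=> [ED EZ Ec E0] Ezs; split.
- move=> a b /= [t [t0 Ea]] [u [u0 Eb]]; exists (t + u); split.
    exact: addr_ge0.
  have := ED _ _ Ea Eb => /=.
  by rewrite addrACA -opprD -scalerDl addrACA -opprD -mulrDl.
- move=> u a u0 /= [t [t0 Ea]]; exists (u * t); split.
    by rewrite mulr_ge0 // ltW.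
  have := EZ _ _ u0 Ea => /=.
  by rewrite scalerBr scalerA mulrBr mulrA.
- move=> w r wr; exists 0; split => //=.
  by rewrite scale0r mul0r !subr0; exact: Ec.
- move=> r /= [t [t0 Er]].
  move: t0; rewrite le_eqVlt => /predU1P[t0|t0].
    by move: Er; rewrite -t0 scale0r mul0r !subr0; exact: E0.
  have /= := Ezs _ _ t t0 Er; rewrite sub0r addNr => /(_ erefl); lra.
Qed.

Lemma epi_cone_sub_maximal c E : epi_cone c E -> exists E' : set (X * R),
  [/\ epi_cone c E', E `<=` E' &
    forall F, epi_cone c F -> E' `<=` F -> F `<=` E'].
Proof.
move=> cE.
pose P := [set F : set (X * R) | F = set0 \/ (epi_cone c F /\ E `<=` F)].
have [|M [PM Mmax]] := @Zorn_bigcup _ P.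
  move=> C CP Ctot.
  have [[F0 [CF0 F0n]]|none] := pselect (exists F, C F /\ F <> set0); last first.
    left; apply/seteqP; split=> // a [F CF Fa].
    by apply: none; exists F; split=> // F0; rewrite F0 in Fa.
  have good F a : C F -> F a -> epi_cone c F.
    by move=> CF Fa; have [F0'|[]//] := CP _ CF; move: Fa; rewrite F0'.
  have [//|[[_ _ F0c _] EF0]] := CP _ CF0.
  right; split; [split|].
  - move=> a b [F CF Fa] [G CG Gb].
    have [[FD _ _ _] [GD _ _ _]] := (good _ _ CF Fa, good _ _ CG Gb).
    have [FG|GF] := Ctot _ _ CF CG.
      by exists G => //; apply: GD => //; exact: FG.
    by exists F => //; apply: FD => //; exact: GF.
  - move=> t a t0 [F CF Fa]; exists F => //.
    by have [_ FZ _ _] := good _ _ CF Fa; exact: FZ.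
  - by move=> z s zs; exists F0 => //; exact: F0c.
  - by move=> s [F CF Fs]; have [_ _ _] := good _ _ CF Fs; exact.
  - by move=> a Ea; exists F0 => //; exact: EF0.
have E00 : E (0, 0) by case: cE => _ _ Ec _; apply: Ec; rewrite normr0 mulr0.
have [M0|[cM EM]] := PM.
  exfalso; apply: (Mmax E); last by right; split.
  by rewrite M0; split=> // /(_ _ E00).
exists M; split=> // F cF MF.
apply: contrapT => FM; apply: (Mmax F); first by split.
by right; split=> //; exact: subset_trans MF.
Qed.

(** A linear functional whose graph separates the convex cone E from the graph of
- c |.|, which lies below it.  Cones of pairs stand for extended real-valued
sublinear functionals; this form serves generalized derivatives, finite
families of inequalities and norming functionals alike. *)
Lemma hahn_banach_sandwich c E : 0 <= c -> E (0, 0) ->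
  (forall a b, E a -> E b -> E (a.1 + b.1, a.2 + b.2)) ->
  (forall (t : R) a, 0 < t -> E a -> E (t *: a.1, t * a.2)) ->
  (forall a, E a -> - (c * `|a.1|) <= a.2) ->
  exists p : {linear X -> R^o},
    (forall z, `|p z : R| <= c * `|z|) /\ (forall a, E a -> (p a.1 : R) <= a.2).
Proof.
move=> c0 E0 ED EZ Ec.
pose E1 := [set a : X * R | exists v s, c * `|v| <= s /\ E (a.1 - v, a.2 - s)].
have cE1 : epi_cone c E1.
  split.
  - move=> a b [v [s [vs Ea]]] [w [r [wr Eb]]]; exists (v + w), (s + r); split=> /=.
      apply: le_trans (lerD vs wr).
      by rewrite -mulrDr ler_wpM2l // ler_normD.
    by rewrite opprD addrACA opprD [in X in (_, X)]addrACA; exact: ED Ea Eb.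
  - move=> t a t0 [v [s [vs Ea]]]; exists (t *: v), (t * s); split=> /=.
      by rewrite normrZ gtr0_norm // mulrCA ler_wpM2l // ltW.
    by rewrite -scalerBr -mulrBr; exact: EZ Ea.
  - by move=> z s zs; exists z, s; rewrite /= !subrr.
  - move=> s [v [r [vr Ea]]]; have := Ec _ Ea => /=; rewrite sub0r normrN; lra.
have [M [[MD MZ Mc M0] E1M Mmax]] := epi_cone_sub_maximal cE1.
have EM a : E a -> M a.
  move=> Ea; apply: E1M; exists 0, 0; rewrite normr0 mulr0; split=> //.
  by rewrite !subr0 -surjective_pairing.
have Mup z s r : s <= r -> M (z, s) -> M (z, r).
  move=> sr Mzs; have /= := MD (z, s) (0, r - s) Mzs.
  by rewrite addr0 [s + _]addrC subrK; apply; apply: Mc; rewrite normr0 mulr0; lra.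
(* If (z, s) cannot be adjoined, some (w, r) in M has w = - t z and r < - t s,
   and rescaling puts (- z, - s) in M. *)
have alt z s : M (z, s) \/ M (- z, - s).
  have [ok|] := pselect (forall w r (t : R), 0 < t -> M (w, r) ->
    w + t *: z = 0 -> 0 <= r + t * s).
    left; apply: (Mmax _ (epi_cone_adjoin (And4 MD MZ Mc M0) ok)).
      by move=> a Ma; exists 0; rewrite scale0r mul0r !subr0 -surjective_pairing.
    exists 1; split=> //=; rewrite scale1r mul1r !subrr.
    by apply: Mc; rewrite normr0 mulr0.
  move=> /existsNP[w] /existsNP[r] /existsNP[t] /not_implyP[t0] /not_implyP[Mw].
  move=> /not_implyP[wz] /negP; rewrite -ltNge => rs; right.
  have ti : 0 < t^-1 by rewrite invr_gt0.
  have /= := MZ _ _ ti Mw.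
  have -> : w = - (t *: z) by apply/eqP; rewrite -addr_eq0 wz.
  rewrite scalerN scalerA mulVf ?gt_eqF // scale1r; apply: Mup.
  rewrite -(ler_pM2l t0) mulrA mulfV ?gt_eqF // mul1r; lra.
pose S z := [set s | M (z, s)].
have lbS z s : S z s -> - (c * `|z|) <= s.
  move=> Mzs; have /= := MD _ _ Mzs (Mc (- z) _ (lexx _)).
  by rewrite subrr normrN => /M0; lra.
have hS z : has_inf (S z).
  split; first by exists (c * `|z|); exact: Mc.
  by exists (- (c * `|z|)) => s; exact: lbS.
pose p z := inf (S z).
have pM z s : M (z, s) -> p z <= s.
  by move=> Mzs; apply: ge_inf => //; have [] := hS z.
have Mp z s : p z < s -> M (z, s).
  move=> ps; have [r Mr rs] : exists2 r, S z r & r < s.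
    have d0 : 0 < s - p z by lra.
    have [r Sr rp] := inf_adherent d0 (hS z).
    by exists r => //; move: rp; rewrite -/(p z); lra.
  exact: Mup (ltW rs) Mr.
(* By [alt] the functional p, which is sublinear, is odd, hence linear. *)
have pN z : p (- z) = - p z.
  apply/eqP; rewrite eq_le; apply/andP; split; last first.
    apply/ler_addgt0Pr => e e0.
    have e2 : 0 < e / 2 by lra.
    have M1 : M (z, p z + e / 2) by apply: Mp; lra.
    have M2 : M (- z, p (- z) + e / 2) by apply: Mp; lra.
    have /= := MD _ _ M1 M2; rewrite subrr => /M0; lra.
  apply/ler_addgt0Pr => e e0.
  have [/pM|/pM] := alt z (p z - e); lra.
have pD z w : p (z + w) = p z + p w.
  have sub a b : p (a + b) <= p a + p b.
    apply/ler_addgt0Pr => e e0.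
    have M1 : M (a, p a + e / 2) by apply: Mp; lra.
    have M2 : M (b, p b + e / 2) by apply: Mp; lra.
    have /= /pM := MD _ _ M1 M2; lra.
  apply/eqP; rewrite eq_le sub /=.
  by have := sub (- z) (- w); rewrite -opprD !pN; lra.
have pZ' (t : R) z : 0 < t -> p (t *: z) <= t * p z.
  move=> t0; apply/ler_addgt0Pr => e e0.
  have M1 : M (z, p z + e / t) by apply: Mp; rewrite ltrDl divr_gt0.
  have /= /pM := MZ _ _ t0 M1; rewrite mulrDr (mulrC t (e / t)) divfK // gt_eqF //.
have pZp (t : R) z : 0 < t -> p (t *: z) = t * p z.
  move=> t0; apply/eqP; rewrite eq_le pZ' //=.
  by have := pZ' _ (- z) t0; rewrite scalerN !pN mulrN lerN2.
have p0 : p 0 = 0 by have := pD 0 0; rewrite addr0; lra.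
have pZ (t : R) z : p (t *: z) = t * p z.
  have [t0|t0|->] := ltgtP t 0; last by rewrite scale0r mul0r.
    rewrite -[t]opprK scaleNr pN pZp ?mulNr //; lra.
  exact: pZp.
have plin : linear (p : X -> R^o) by move=> t z w; rewrite pD pZ.
pose L := GRing.isLinear.Build R X R^o _ p plin.
pose pl : {linear X -> R^o} := HB.pack (p : X -> R^o) L.
exists pl; split; last by case=> z s /EM /pM.
move=> z; rewrite ler_norml; apply/andP; split; last by apply: pM; exact: Mc.
by have := pM _ _ (Mc (- z) _ (lexx _)); rewrite pN normrN /=; lra.
Qed.

End hahn_banach.

(** * Perturbed minima in complete metric spaces *)

Section perturbed_minimum.
Context (R : realType).

Lemma near_minimizer (T : Type) (F : T -> \bar R) (b eps : R) (x : T) :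
  (forall v, b%:E <= F v)%E -> (F x < +oo)%E -> 0 < eps ->
  exists2 y, (F y < +oo)%E & forall v, (F y <= F v + eps%:E)%E.
Proof.
move=> bF Fx e0.
have ifin : ereal_inf (range F) \is a fin_num.
  rewrite fin_numE; apply/andP; split.
    rewrite -ltNye; apply: (@lt_le_trans _ _ b%:E); first exact: ltNyr.
    by apply: le_ereal_inf_tmp => _ [v _ <-].
  by rewrite -ltey; apply: le_lt_trans Fx; apply: ereal_inf_lbound; exists x.
have [_ [y _ <-] Fy] := lb_ereal_inf_adherent e0 ifin.
exists y; first by apply: lt_trans Fy _; rewrite -(fineK ifin) -EFinD ltry.
move=> v; apply: (le_trans (ltW Fy)).
by rewrite leeD2r //; apply: ereal_inf_lbound; exists v.
Qed.

Lemma geometric_small (C e : R) : 0 < e ->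
  \forall n \near \oo, C * 2^-1 ^+ n < e.
Proof.
move=> e0.
have : C * 2^-1 ^+ n @[n --> \oo] --> (C * 0 : R).
  apply: cvgMr; apply: cvg_expr; rewrite ger0_norm ?invr_ge0 //.
  by rewrite invf_lt1 ?ltr1n.
by rewrite mulr0 => /cvgr_lt; apply.
Qed.

Context (X : metricType R).

(** The weights sum to delta, so that for 1-Lipschitz phi all the perturbations
are delta-Lipschitz and the one of index n differs from all later ones by a
function with Lipschitz constant delta / 2 ^ n. *)
Definition perturbation (delta : R) (phi : nat -> X -> X -> R) (y : nat -> X)
    (n : nat) (v : X) : R :=
  \sum_(k < n) delta * 2^-1 ^+ k.+1 * phi k (y k) v.

Lemma perturbationS delta phi y n v : perturbation delta phi y n.+1 v =
  perturbation delta phi y n v + delta * 2^-1 ^+ n.+1 * phi n (y n) v.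
Proof. by rewrite /perturbation big_ord_recr. Qed.

Lemma perturbation_tail delta phi y (n m : nat) v w : 0 <= delta ->
  (forall k y v w, phi k y v - phi k y w <= mdist v w) -> (n <= m)%N ->
  (perturbation delta phi y m v - perturbation delta phi y n v)
  - (perturbation delta phi y m w - perturbation delta phi y n w)
  <= delta * (2^-1 ^+ n - 2^-1 ^+ m) * mdist v w.
Proof.
move=> d0 lip; elim: m => [|m IH].
  by rewrite leqn0 => /eqP ->; rewrite !subrr mulr0 mul0r.
rewrite leq_eqVlt => /predU1P[->|]; first by rewrite !subrr mulr0 mul0r.
rewrite ltnS => /IH {}IH; rewrite !perturbationS.
have p0 : 0 <= delta * 2^-1 ^+ m.+1 by rewrite mulr_ge0 // exprn_ge0 // invr_ge0.
have := ler_wpM2l p0 (lip m (y m) v w); rewrite mulrBr => l.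
have -> : delta * (2^-1 ^+ n - 2^-1 ^+ m.+1) * mdist v w =
  delta * (2^-1 ^+ n - 2^-1 ^+ m) * mdist v w + delta * 2^-1 ^+ m.+1 * mdist v w.
  by rewrite exprS; field.
lra.
Qed.

Lemma cauchy_geometric (y : nat -> X) (C : R) : complete_metric X ->
  (forall n, mdist (y n.+1) (y n) <= C * 2^-1 ^+ n) -> exists u : X, y @ \oo --> u.
Proof.
move=> cX yC.
have dist n k : mdist (y (n + k)%N) (y n) <= 2 * C * (2^-1 ^+ n - 2^-1 ^+ (n + k)).
  elim: k => [|k IH]; first by rewrite addn0 mdistxx subrr mulr0.
  rewrite addnS; apply: le_trans (metric_triangle _ (y (n + k)%N) _) _.
  have := yC (n + k)%N; rewrite exprS; lra.
have C0 : 0 <= C.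
  by have := yC 0%N; rewrite expr0 mulr1; apply: le_trans; exact: mdist_ge0.
apply: cX; apply: cauchy_exP => e e0.
have [N _ HN] := geometric_small (2 * C) e0.
exists (y N); exists N => // n /= Nn; rewrite ballEmdist /= metric_sym.
have := dist N (n - N)%N; rewrite subnKC // => /le_lt_trans; apply.
apply: le_lt_trans (HN N (leqnn N)).
by rewrite ler_wpM2l ?mulr_ge0 // gerBl exprn_ge0 // invr_ge0.
Qed.

(** A smooth variational principle: phi k (y k) is only required to approximate
the distance to y k, so that it may be chosen differentiable.  Each y n nearly
minimizes f plus the n-th perturbation, hence lies within O(2 ^ - n) of
y n.+1, and u is the limit of the sequence.  The conclusion expresses that u
minimizes f plus the whole series of perturbations; stating it for the partial
sums, with the Lipschitz constant of the remainder, dispenses with the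
convergence of that series. *)
Lemma perturbed_minimum (f : X -> \bar R) (b delta : R)
    (phi : nat -> X -> X -> R) (x : X) :
  complete_metric X -> lower_semicontinuous f -> (forall v, b%:E <= f v)%E ->
  (f x < +oo)%E -> 0 < delta ->
  (forall k y v, mdist v y - 2^-1 ^+ k <= phi k y v <= mdist v y) ->
  (forall k y v w, phi k y v - phi k y w <= mdist v w) ->
  exists y u, (f u < +oo)%E /\
    forall n v, (f u + (perturbation delta phi y n u)%:E <=
      f v + (perturbation delta phi y n v + delta * 2^-1 ^+ n * mdist v u)%:E)%E.
Proof.
move=> cX lf bf fx d0 phid phil.
have h0 n : 0 < (2^-1 : R) ^+ n by rewrite exprn_gt0 // invr_gt0.
pose Q (P : X -> R) (e : R) := [set y | (f y < +oo)%E /\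
  forall v, (f y + (P y)%:E <= f v + (P v + e)%:E)%E].
pose near P (e : R) := xget x (Q P e).
(* The centers and the perturbations are defined together: [st n] is the n-th
   perturbation, and its near minimizer is the next center.  The tolerance is
   the weight of the next term times 2 ^ - n. *)
pose st := fix st n : X -> R := if n is m.+1 then
    fun v => st m v + delta * 2^-1 ^+ m.+1 *
      phi m (near (st m) (delta * 2^-1 ^+ (m + m).+1)) v
   else fun _ => 0.
pose y n := near (st n) (delta * 2^-1 ^+ (n + n).+1).
have stE n : st n = perturbation delta phi y n.
  elim: n => [|n IH]; first by apply/funext => v; rewrite /perturbation big_ord0.
  by apply/funext => v; rewrite perturbationS -IH.
set P := perturbation delta phi y in stE *.
have P0 v : P 0%N v = 0 by rewrite /P /perturbation big_ord0.
have Pge n v : - delta <= P n v.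
  suff : - (delta * (1 - 2^-1 ^+ n)) <= P n v.
    by apply: le_trans; rewrite lerN2; have := mulr_gt0 d0 (h0 n); lra.
  elim: n => [|n IH]; first by rewrite /P /perturbation big_ord0 expr0 subrr mulr0 oppr0.
  rewrite /P perturbationS -/P.
  have p1 : -1 <= phi n (y n) v.
    have /andP[] := phid n (y n) v; have := mdist_ge0 v (y n).
    have : (2^-1 : R) ^+ n <= 1 by rewrite exprn_ile1 // invf_le1 ?ler1n.
    lra.
  have := ler_wpM2l (ltW (mulr_gt0 d0 (h0 n.+1))) p1.
  move: IH; rewrite [2^-1 ^+ n.+1]exprS; lra.
have ymin n : (f (y n) < +oo)%E /\ forall v, (f (y n) + (P n (y n))%:E <=
    f v + (P n v + delta * 2^-1 ^+ (n + n).+1)%:E)%E.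
  rewrite -stE; apply: (@xgetPex _ x (Q (st n) _)).
  have e0 : 0 < delta * 2^-1 ^+ (n + n).+1 by rewrite mulr_gt0.
  have [||z zdom zmin] := @near_minimizer X (fun v => f v + (st n v)%:E)%E
    (b - delta) _ x _ _ e0.
  - move=> v; rewrite EFinD; apply: leeD => //.
    by rewrite lee_fin stE.
  - by rewrite lte_add_pinfty ?ltry.
  exists z; split.
    by move: zdom; case: (f z) => [r| |]; rewrite ?ltry ?addye.
  by move=> v; rewrite EFinD addeA.
have fN v : f v != -oo%E by rewrite -ltNye; apply: lt_le_trans (bf v); exact: ltNyr.
have yfin n : f (y n) \is a fin_num by rewrite fin_numE fN -ltey; case: (ymin n).
(* Adding the n-th term penalizes the distance to y n, at which its own value
   is nonpositive; this confines the next near minimizer. *)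
have ystep n : mdist (y n.+1) (y n) <= 3 * 2^-1 ^+ n.
  have [_ m0] := ymin n; have [_ m1] := ymin n.+1.
  have := m0 (y n.+1); have := m1 (y n).
  rewrite -(fineK (yfin n)) -(fineK (yfin n.+1)) -!EFinD !lee_fin /P !perturbationS -/P.
  have /andP[l1 _] := phid n (y n) (y n.+1).
  have /andP[_ l2] := phid n (y n) (y n); rewrite mdistxx in l2.
  have q0 := mulr_gt0 d0 (h0 n.+1).
  have := ler_wpM2l (ltW q0) l1; have := ler_wpM2l (ltW q0) l2.
  have e1 : 2^-1 ^+ (n + n).+1 = (2^-1 : R) ^+ n.+1 * 2^-1 ^+ n by rewrite -exprD addSn.
  have e2 : 2^-1 ^+ (n.+1 + n.+1).+1 = 2^-1 * 2^-1 * ((2^-1 : R) ^+ n.+1 * 2^-1 ^+ n).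
    by rewrite -exprD -expr2 -exprD; congr (_ ^+ _); lia.
  rewrite e1 e2 => a1 a2 a3 a4.
  rewrite -(ler_pM2l q0).
  have := mulr_gt0 q0 (h0 n); lra.
have [u yu] := cauchy_geometric cX ystep.
(* For m >= n the point y m nearly minimizes f plus the m-th perturbation;
   replacing the latter by the n-th one costs delta / 2 ^ n times the distance
   from v to y m.  As m grows, lower semicontinuity at u allows passing to the
   limit. *)
have main n v : (f u + (P n u)%:E <= f v + (P n v + delta * 2^-1 ^+ n * mdist v u)%:E)%E.
  have [fv|] := ltP (f v) +oo%E; last first.
    by rewrite leye_eq => /eqP ->; rewrite addye ?leey // -ltNye ltNyr.
  have fvfin : f v \is a fin_num by rewrite fin_numE fN -ltey.
  rewrite leNgt; apply/negP.
  set A := P n v + delta * 2^-1 ^+ n * mdist v u - P n u + fine (f v).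
  move=> lt.
  have Au : (A%:E < f u)%E.
    move: lt; rewrite -{1}(fineK fvfin) -EFinD.
    have := fN u; case: (f u) => [r _|_ _|]; [|by rewrite ltry|by rewrite eqxx].
    rewrite -EFinD !lte_fin /A; lra.
  have [a Aa au] : exists2 a, A < a & (a%:E < f u)%E.
    move: Au; case: (f u) => [r| |] //.
      by rewrite lte_fin => /midf_lt[? ?]; exists ((A + r) / 2); rewrite ?lte_fin.
    by move=> _; exists (A + 1); rewrite ?ltry ?ltrDl.
  have [V Vu Va] := lf _ _ au.
  have yV : \forall m \near \oo, V (y m) by apply: yu.
  pose e := (a - A) / 4.
  have e0 : 0 < e by rewrite divr_gt0 // subr_gt0.
  pose e' := Num.min e (e / delta).
  have e'0 : 0 < e' by rewrite lt_min e0 divr_gt0.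
  have yd : \forall m \near \oo, mdist u (y m) < e'.
    by move/metricType_numDomainType.cvgrPdist_lt : yu; apply.
  have small := geometric_small delta e0.
  near \oo => m.
  have nm : (n <= m)%N by near: m; exact: nbhs_infty_ge.
  have dm : mdist u (y m) < e' by near: m.
  have sm : delta * 2^-1 ^+ m < e by near: m.
  have am : (a%:E < f (y m))%E by apply: Va; near: m.
  have [_ /(_ v)] := ymin m.
  move: am; rewrite -(fineK (yfin m)) -(fineK fvfin) -!EFinD lte_fin lee_fin => am mm.
  have t1 := perturbation_tail y v (y m) (ltW d0) phil nm.
  have t2 := perturbation_tail y u (y m) (ltW d0) phil (leq0n n).
  rewrite -/P !P0 expr0 !subr0 in t2.
  rewrite -/P in t1.
  have tri := metric_triangle v u (y m).
  have hn1 : (2^-1 : R) ^+ n <= 1 by rewrite exprn_ile1 // invf_le1 ?ler1n.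
  have b1 : delta * (2^-1 ^+ n - 2^-1 ^+ m) * mdist v (y m)
     <= delta * 2^-1 ^+ n * mdist v u + delta * mdist u (y m).
    apply: (@le_trans _ _ (delta * 2^-1 ^+ n * (mdist v u + mdist u (y m)))).
      apply: ler_pM => //; rewrite ?mdist_ge0 // ?ler_pM2l // ?gerBl ?(ltW (h0 _)) //.
      rewrite mulr_ge0 ?subr_ge0 ?(ltW d0) //.
      by rewrite ler_wiXn2l // ?invr_ge0 // invf_le1 ?ler1n.
    rewrite mulrDr lerD2l ler_wpM2r ?mdist_ge0 // ger_pMr //.
  have b2 : delta * (1 - 2^-1 ^+ n) * mdist u (y m) <= delta * mdist u (y m).
    rewrite ler_wpM2r ?mdist_ge0 // ger_pMr // gerBl ltW //.
  have b3 : delta * mdist u (y m) < e.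
    by rewrite mulrC -ltr_pdivlMr //; move: dm; rewrite lt_min => /andP[].
  have b4 : delta * 2^-1 ^+ (m + m).+1 <= delta * 2^-1 ^+ m.
    rewrite ler_pM2l //; apply: ler_wiXn2l; rewrite ?invr_ge0 ?invf_le1 ?ler1n //.
    by rewrite -addnS leq_addr.
  move: Aa am mm sm b3 b4 t1 t2 b1 b2; rewrite /e /A; clear; lra.
exists y, u; split=> //.
have : (f u + (P 0 u)%:E < +oo)%E.
  by apply: le_lt_trans (main 0%N x) _; rewrite lte_add_pinfty ?ltry.
by case: (f u) => [r| |]; rewrite ?ltry ?addye.
Unshelve. all: by end_near.
Qed.
End perturbed_minimum.

(** * Lower semicontinuity and the variational principle of Ekeland *)

Section semicontinuity.
Context (R : realType) (X : metricType R).
Implicit Types (f : X -> \bar R) (q : X -> R).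
Local Open Scope ereal_scope.

Lemma ereal_between (a : R) (y : \bar R) : a%:E < y ->
  exists2 b : R, (a < b)%R & b%:E < y.
Proof.
case: y => [r| |] //.
  by rewrite lte_fin => /midf_lt[? ?]; exists ((a + r) / 2)%R; rewrite ?lte_fin.
by move=> _; exists (a + 1)%R; rewrite ?ltry ?ltrDl.
Qed.

Lemma lsc_add_lipschitz f q (L : R) : lower_semicontinuous f ->
  (forall v w, q v - q w <= L * mdist v w)%R ->
  lower_semicontinuous (fun v => f v + (q v)%:E).
Proof.
move=> lf lq x a afx.
have afx' : (a - q x)%:E < f x.
  by rewrite EFinB lteBlDr.
have [b ab bf] := ereal_between afx'.
have [V Vx Vb] := lf _ _ bf.
pose e := ((b - (a - q x)) / (`|L| + 1))%R.
have L1 : (0 < `|L| + 1)%R by rewrite ltr_wpDl.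
have e0 : (0 < e)%R by rewrite divr_gt0 // subr_gt0.
exists (V `&` ball x e); first by apply: filterI => //; exact: nbhsx_ballx.
move=> y [Vy]; rewrite ballEmdist /= => xy.
rewrite -lteBlDr // -EFinB; apply: le_lt_trans (Vb _ Vy).
have := lq x y.
have : (L * mdist x y <= b - (a - q x))%R.
  rewrite -[leRHS](divfK (lt0r_neq0 L1)) -/e mulrC.
  apply: (@le_trans _ _ (mdist x y * (`|L| + 1))%R).
    by rewrite ler_wpM2l ?mdist_ge0 //; have := ler_norm L; lra.
  by rewrite ler_wpM2r // ltW.
by rewrite lee_fin; lra.
Qed.

Lemma lsc_max0 f : lower_semicontinuous f -> lower_semicontinuous (fun v => maxe (f v) 0).
Proof.
move=> lf x a; rewrite lt_max => /orP[/lf[V Vx Va]|a0].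
  by exists V => // y /Va; rewrite lt_max => ->.
by exists setT; [exact: filterT|move=> y _; rewrite lt_max a0 orbT].
Qed.

Lemma lsc_restrict f (Y : set X) : closed Y -> lower_semicontinuous f ->
  lower_semicontinuous (fun v => if v \in Y then f v else +oo).
Proof.
move=> cY lf x a; case: ifPn => [xY /lf[V Vx Va]|].
  by exists V => // y /Va; case: ifPn => // _ _; rewrite ltry.
rewrite notin_setE => xY _; exists (~` Y).
  by apply: open_nbhs_nbhs; split => //; exact: closed_openC.
by move=> y yY; rewrite memNset ?ltry.
Qed.

End semicontinuity.

Section ekeland.
Context (R : realType) (X : metricType R).
Local Open Scope ereal_scope.

(** Obtained from [perturbed_minimum] with the exact distance as gauge, applied
to f + c d(., x): the perturbations change slopes by at most delta. *)
Lemma ekeland (f : X -> \bar R) (x : X) (c delta : R) :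
  complete_metric X -> lower_semicontinuous f -> (forall v, 0 <= f v) ->
  f x < +oo -> (0 < c)%R -> (0 < delta)%R ->
  exists u, f u + ((c - delta) * mdist u x)%:E <= f x /\
    forall v, f u <= f v + ((c + delta) * mdist u v)%:E.
Proof.
move=> cX lf f0 fx c0 d0.
have lip v w : (c * mdist v x - c * mdist w x <= c * mdist v w)%R.
  by rewrite -mulrBr ler_pM2l //; have := metric_triangle v w x; lra.
have lg := lsc_add_lipschitz lf lip.
have [||||y [u [udom umin]]] := @perturbed_minimum R X _ 0%R delta
   (fun _ y v => mdist v y) x cX lg _ _ d0.
- by move=> v; rewrite adde_ge0 // lee_fin mulr_ge0 ?mdist_ge0 // ltW.
- by rewrite lte_add_pinfty ?ltry.
- by move=> k y v; rewrite lexx andbT gerBl exprn_ge0 // invr_ge0.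
- by move=> k y v w; have := metric_triangle v w y; lra.
have um v : f u + (c * mdist u x)%:E <= f v + (c * mdist v x + delta * mdist v u)%:E.
  have := umin 0%N v; rewrite /perturbation !big_ord0 expr0 mulr1 add0r.
  by rewrite adde0 -addeA -EFinD.
have ufin : f u \is a fin_num.
  by rewrite ge0_fin_numE //; move: udom; case: (f u) => [r| |]; rewrite ?ltry ?addye.
exists u; split.
  have := um x; rewrite mdistxx mulr0 add0r (metric_sym x u).
  have := f0 x; case: (f x) => [r _|_ _|//]; last by rewrite leey.
  rewrite -(fineK ufin) -!EFinD !lee_fin; lra.
move=> v; have := um v; have := lip v u; rewrite (metric_sym v u).
have := f0 v; case: (f v) => [r _|_ _ _|//]; last by rewrite addye ?leey.
rewrite -(fineK ufin) -!EFinD !lee_fin; lra.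
Qed.
End ekeland.

(** * The dual ball of a subspace *)

Lemma countable_range (T : pointedType) (D : set T) : countable D ->
  exists g : nat -> T, D `<=` range g.
Proof.
move=> /countable_injP[f finj].
exists (fun n => xget point [set d | D d /\ f d = n]) => d Dd.
exists (f d) => //.
have [Dx fx] : [set e | D e /\ f e = f d] (xget point [set e | D e /\ f e = f d]).
  by apply: xgetPex; exists d.
by apply: finj => //; rewrite inE.
Qed.

Section dual_ball.
Context (R : realType) (X : normedModType R) (Y : set X).
Hypothesis Ysub : linear_subspace Y.
Implicit Types (p q r : X -> R).

(** Functionals are plain functions, so that a limit of functionals along an
ultrafilter can be formed pointwise before it is known to be linear. *)
Definition dual_ball : set (X -> R) :=
  [set p | (forall a u v, p (a *: u + v) = a * p u + p v)
           /\ forall z, `|p z| <= `|z|].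

(** The norm of p - q restricted to Y: the metric of the dual of Y, in which
separability is assumed, although p and q are functionals on X. *)
Definition dual_dist p q : R := sup [set `|p z - q z| | z in [set z | Y z /\ `|z| <= 1]].

Lemma dual_ball0 : dual_ball (fun=> 0).
Proof. by split=> [a u v|z]; rewrite ?mulr0 ?addr0 // normr0. Qed.

Lemma dual_ballD p u v : dual_ball p -> p (u + v) = p u + p v.
Proof. by move=> [pl _]; rewrite -[u]scale1r pl mul1r scale1r. Qed.

Lemma dual_ball_0 p : dual_ball p -> p 0 = 0.
Proof. by move=> pb; have := dual_ballD 0 0 pb; rewrite addr0; lra. Qed.

Lemma dual_ballZ p a v : dual_ball p -> p (a *: v) = a * p v.
Proof.
by move=> pb; have [pl _] := pb; rewrite -[a *: v]addr0 pl (dual_ball_0 pb) addr0.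
Qed.

Lemma dual_ballB p u v : dual_ball p -> p (u - v) = p u - p v.
Proof. by move=> pb; rewrite dual_ballD // -scaleN1r dual_ballZ // mulN1r. Qed.

Lemma dual_ball_mid p q : dual_ball p -> dual_ball q ->
  dual_ball (fun z => (p z + q z) / 2).
Proof.
move=> [pl pb] [ql qb]; split=> [a u v|z]; first by rewrite pl ql; field.
have := ler_normD (p z) (q z); have := pb z; have := qb z.
rewrite normrM (ger0_norm (_ : 0 <= 2^-1 :> R)) ?invr_ge0 //; lra.
Qed.

Lemma dual_dist_le p q M : (forall z, Y z -> `|z| <= 1 -> `|p z - q z| <= M) ->
  dual_dist p q <= M.
Proof.
move=> pM; apply: ge_sup; last by move=> _ [z [Yz z1] <-]; exact: pM.
exists `|p 0 - q 0|; exists 0 => //; split; first by case: Ysub.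
by rewrite normr0.
Qed.

Lemma dual_dist_has_sup p q : dual_ball p -> dual_ball q ->
  has_sup [set `|p z - q z| | z in [set z | Y z /\ `|z| <= 1]].
Proof.
move=> [_ pb] [_ qb]; split.
  exists `|p 0 - q 0|; exists 0 => //; split; first by case: Ysub.
  by rewrite normr0.
exists 2 => _ [z [Yz z1] <-]; apply: le_trans (ler_normB _ _) _.
have := pb z; have := qb z; lra.
Qed.

Lemma le_dual_dist p q z : dual_ball p -> dual_ball q -> Y z -> `|z| <= 1 ->
  `|p z - q z| <= dual_dist p q.
Proof.
move=> pb qb Yz z1; apply: ub_le_sup; last by exists z.
by case: (dual_dist_has_sup pb qb).
Qed.

Lemma dual_distM p q z : dual_ball p -> dual_ball q -> Y z ->
  `|p z - q z| <= dual_dist p q * `|z|.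
Proof.
move=> pb qb Yz; have [->|z0] := eqVneq z 0.
  by rewrite (dual_ball_0 pb) (dual_ball_0 qb) subrr !normr0 mulr0.
have z1 : 0 < `|z| by rewrite normr_gt0.
rewrite -ler_pdivrMr //.
have /= := @le_dual_dist p q (`|z|^-1 *: z) pb qb.
rewrite (dual_ballZ _ _ pb) (dual_ballZ _ _ qb) -mulrBr normrM.
rewrite ger0_norm ?invr_ge0 // mulrC; apply.
  by have [Y0 Yl] := Ysub; rewrite -[_ *: z]addr0; exact: Yl.
by rewrite normrZ ger0_norm ?invr_ge0 // mulVf // gt_eqF.
Qed.

Lemma dual_dist_ge0 p q : dual_ball p -> dual_ball q -> 0 <= dual_dist p q.
Proof.
move=> pb qb; apply: le_trans (le_dual_dist pb qb (proj1 Ysub) _) => //.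
by rewrite normr0.
Qed.

Lemma dual_dist_le2 p q : dual_ball p -> dual_ball q -> dual_dist p q <= 2.
Proof.
move=> [_ pb] [_ qb]; apply: dual_dist_le => z Yz z1.
apply: le_trans (ler_normB _ _) _.
have := pb z; have := qb z; lra.
Qed.

Lemma dual_dist_triangle p q r : dual_ball p -> dual_ball q -> dual_ball r ->
  dual_dist p r <= dual_dist p q + dual_dist q r.
Proof.
move=> pb qb rb; apply: dual_dist_le => z Yz z1.
have := le_dual_dist pb qb Yz z1; have := le_dual_dist qb rb Yz z1.
have := ler_normD (p z - q z) (q z - r z); rewrite addrA subrK; lra.
Qed.

Lemma dual_dist_sym p q : dual_dist p q = dual_dist q p.
Proof. by congr sup; apply: eq_imagel => z _; rewrite distrC. Qed.

Lemma dual_dist_mid p q r : dual_ball p -> dual_ball q -> dual_ball r ->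
  dual_dist (fun z => (p z + q z) / 2) r <= (dual_dist p r + dual_dist q r) / 2.
Proof.
move=> pb qb rb; apply: dual_dist_le => z Yz z1.
have := le_dual_dist pb rb Yz z1; have := le_dual_dist qb rb Yz z1.
have -> : (p z + q z) / 2 - r z = ((p z - r z) + (q z - r z)) / 2 by field.
have := ler_normD (p z - r z) (q z - r z).
rewrite normrM (ger0_norm (_ : 0 <= 2^-1 :> R)) ?invr_ge0 //; lra.
Qed.

Lemma dual_ball_dual_on p : dual_ball p -> dual_on Y p.
Proof.
move=> pb; split; first by move=> a u v _ _; case: pb.
apply: continuous_subspaceT => x; apply/cvgrPdist_lt => e e0.
near=> y; rewrite -(dual_ballB _ _ pb); have [_ pb'] := pb.
apply: le_lt_trans (pb' _) _; near: y.
by apply: cvgr_dist_lt.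
Unshelve. all: by end_near.
Qed.

(** The functionals that are dense in the dual of Y need not be restrictions of
elements of the dual ball of X; near each of them an element of the ball is
selected, for each precision at which there is one. *)
Lemma dual_ball_dense : separable_dual_on Y ->
  exists q : nat -> X -> R, (forall n, dual_ball (q n)) /\
    forall p, dual_ball p -> forall e, 0 < e -> exists n, dual_dist p (q n) < e.
Proof.
move=> [D [cD DY Ddense]].
have [g Dg] := @countable_range (X -> R) D cD.
pose Q i k := [set p | dual_ball p /\
  (dual_norm_on Y (fun z => p z - g i z)%R < (k.+1%:R^-1)%:E)%E].
pose q n := let: (i, k) := odflt (0, 0)%N (unpickle n) in xget (fun=> 0) (Q i k).
exists q; split.
  move=> n; rewrite /q; case: (odflt _ _) => i k.
  by case: xgetP => [p _ []//|_]; exact: dual_ball0.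
move=> p pb e e0.
have [k ke] : exists k, 2 * (k.+1%:R^-1 : R) < e.
  have e2 : 0 < e / 2 by rewrite divr_gt0.
  have := near_infty_natSinv_lt (PosNum e2) => -[k _ /(_ k (leqnn k)) /= h].
  by exists k; move: h; rewrite [ltRHS]/= ltr_pdivlMr // mulrC.
have k0 : (0 : R) < k.+1%:R^-1 by rewrite invr_gt0.
have [d Dd pd] := Ddense p (dual_ball_dual_on pb) _ k0.
have [i _ gi] := Dg _ Dd.
exists (pickle (i, k)); rewrite /q pickleK /=.
have [qb qd] : Q i k (xget (fun=> 0) (Q i k)).
  by apply: xgetPex; exists p; split=> //; rewrite gi.
move: (xget _ _) qb qd => r rb rd.
apply: le_lt_trans ke; apply: dual_dist_le => z Yz z1.
have bnd s : (dual_norm_on Y (fun z => s z - g i z)%R < (k.+1%:R^-1)%:E)%E ->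
    `|s z - g i z| < k.+1%:R^-1.
  move=> h; rewrite -lte_fin; apply: le_lt_trans h.
  by apply: ereal_sup_ubound; exists z.
have := bnd r rd; have := bnd p; rewrite gi => /(_ pd).
have := ler_normB (p z - d z) (r z - d z).
have -> : p z - d z - (r z - d z) = p z - r z by ring.
by move: (k.+1%:R^-1 : R) => c; lra.
Qed.

End dual_ball.

(** * Smooth approximation of the norm *)

Section smooth_norm.
Context (R : realType) (X : normedModType R) (Y : set X).
Hypothesis Ysub : linear_subspace Y.
Context (q : nat -> X -> R).
Hypothesis qball : forall n, dual_ball (q n).
Hypothesis qdense :
  forall p, dual_ball p -> forall e, 0 < e -> exists n, dual_dist Y p (q n) < e.
Implicit Types (p r : X -> R) (z : X).

Let h n : (2^-1 : R) ^+ n > 0. Proof. by rewrite exprn_gt0 // invr_gt0. Qed.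

Definition penalty_sum (n : nat) p : R :=
  \sum_(k < n) 2^-1 ^+ k.+1 * dual_dist Y p (q k) ^+ 2.

(** The partial sums increase and are bounded on the dual ball, so that the supremum
is the sum of the series there. *)
Definition penalty p : R := sup (range (penalty_sum ^~ p)).

Let penalty_sumS n p :
  penalty_sum n.+1 p = penalty_sum n p + 2^-1 ^+ n.+1 * dual_dist Y p (q n) ^+ 2.
Proof. by rewrite /penalty_sum big_ord_recr. Qed.

Let penalty_sum_homo p m n : (m <= n)%N -> penalty_sum m p <= penalty_sum n p.
Proof.
elim: n => [|n IH]; first by rewrite leqn0 => /eqP ->.
rewrite leq_eqVlt ltnS => /predU1P[->//|/IH]; move=> /le_trans; apply.
by rewrite penalty_sumS lerDl mulr_ge0 ?sqr_ge0 // ltW.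
Qed.

Let penalty_sum_le4 p n : dual_ball p -> penalty_sum n p <= 4.
Proof.
move=> pb; suff : penalty_sum n p <= 4 * (1 - 2^-1 ^+ n) by have := h n; lra.
elim: n => [|n IH]; first by rewrite /penalty_sum big_ord0 expr0 subrr mulr0.
rewrite penalty_sumS.
have d2 := dual_dist_le2 Ysub pb (qball n).
have d0 := dual_dist_ge0 Ysub pb (qball n).
have : dual_dist Y p (q n) ^+ 2 <= 4 by rewrite expr2; nra.
move=> /(ler_wpM2l (ltW (h n.+1))); rewrite [2^-1 ^+ n.+1]exprS; lra.
Qed.

Let penalty_has_sup p : dual_ball p -> has_sup (range (penalty_sum ^~ p)).
Proof.
move=> pb; split; first by exists (penalty_sum 0 p); exists 0%N.
by exists 4 => _ [n _ <-]; exact: penalty_sum_le4.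
Qed.

Let le_penalty p n : dual_ball p -> penalty_sum n p <= penalty p.
Proof. by move=> pb; apply: ub_le_sup; [case: (penalty_has_sup pb)|exists n]. Qed.

Let penalty_le p c : (forall n, penalty_sum n p <= c) -> penalty p <= c.
Proof.
move=> pc; apply: ge_sup; first by exists (penalty_sum 0 p); exists 0%N.
by move=> _ [n _ <-].
Qed.

Let penalty_ge0 p : dual_ball p -> 0 <= penalty p.
Proof. by move=> /(le_penalty 0); rewrite /penalty_sum big_ord0. Qed.

Let penalty_le4 p : dual_ball p -> penalty p <= 4.
Proof. by move=> pb; apply: penalty_le => n; exact: penalty_sum_le4. Qed.

(** The uniform convexity of squares: at midpoints the penalty drops by an amount
controlled by the difference of the distances of p and r to each q n.  This is
what makes maximizing functionals converge. *)
Lemma penalty_midpoint p r n : dual_ball p -> dual_ball r ->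
  penalty (fun z => (p z + r z) / 2)
  + 2^-1 ^+ n.+1 * ((dual_dist Y p (q n) - dual_dist Y r (q n)) / 2) ^+ 2
  <= (penalty p + penalty r) / 2.
Proof.
move=> pb rb; rewrite -lerBrDr; apply: penalty_le => N.
have step k : dual_dist Y (fun z => (p z + r z) / 2) (q k) ^+ 2 <=
    (dual_dist Y p (q k) ^+ 2 + dual_dist Y r (q k) ^+ 2) / 2
    - ((dual_dist Y p (q k) - dual_dist Y r (q k)) / 2) ^+ 2.
  have := dual_dist_mid Ysub pb rb (qball k).
  have := dual_dist_ge0 Ysub (dual_ball_mid pb rb) (qball k).
  rewrite !expr2; nra.
have weak k : penalty_sum k (fun z => (p z + r z) / 2) <=
    (penalty_sum k p + penalty_sum k r) / 2.
  elim: k => [|k IH]; first by rewrite /penalty_sum !big_ord0 addr0 mul0r.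
  rewrite !penalty_sumS.
  have := ler_wpM2l (ltW (h k.+1)) (step k).
  have := sqr_ge0 ((dual_dist Y p (q k) - dual_dist Y r (q k)) / 2).
  move/(mulr_ge0 (ltW (h k.+1))); lra.
have strong k : (n < k)%N -> penalty_sum k (fun z => (p z + r z) / 2) <=
    (penalty_sum k p + penalty_sum k r) / 2
    - 2^-1 ^+ n.+1 * ((dual_dist Y p (q n) - dual_dist Y r (q n)) / 2) ^+ 2.
  elim: k => // k IH; rewrite ltnS leq_eqVlt => /predU1P[nk|/IH {}IH].
    rewrite -nk !penalty_sumS; have := weak n.
    have := ler_wpM2l (ltW (h n.+1)) (step n); lra.
  rewrite !penalty_sumS.
  have := ler_wpM2l (ltW (h k.+1)) (step k).
  have := sqr_ge0 ((dual_dist Y p (q k) - dual_dist Y r (q k)) / 2).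
  move/(mulr_ge0 (ltW (h k.+1))); lra.
apply: (@le_trans _ _ (penalty_sum (maxn N n.+1) (fun z => (p z + r z) / 2))).
  by apply: penalty_sum_homo; rewrite leq_maxl.
have := strong (maxn N n.+1); rewrite leq_maxr => /(_ isT).
have := le_penalty (maxn N n.+1) pb; have := le_penalty (maxn N n.+1) rb; lra.
Qed.

Context (eta : R).
Hypothesis eta0 : 0 < eta.

Definition penalized z p : R := p z - eta * penalty p.

(** Up to the penalty this is the formula |z| = sup p z over the dual ball. *)
Definition smooth_norm z : R := sup [set penalized z p | p in @dual_ball R X].

Let penalized_le z p : dual_ball p -> penalized z p <= `|z|.
Proof.
move=> pb; have := mulr_ge0 (ltW eta0) (penalty_ge0 pb); have [_ /(_ z)] := pb.
have := ler_norm (p z); rewrite /penalized; lra.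
Qed.

Let smooth_has_sup z : has_sup [set penalized z p | p in @dual_ball R X].
Proof.
split; first by exists (penalized z (fun=> 0)); exists (fun=> 0) => //; exact: dual_ball0.
by exists `|z| => _ [p pb <-]; exact: penalized_le.
Qed.

Lemma le_smooth_norm z p : dual_ball p -> penalized z p <= smooth_norm z.
Proof. by move=> pb; apply: ub_le_sup; [case: (smooth_has_sup z)|exists p]. Qed.

Lemma smooth_norm_le z c : (forall p, dual_ball p -> penalized z p <= c) ->
  smooth_norm z <= c.
Proof.
move=> pc; apply: ge_sup; first by case: (smooth_has_sup z).
by move=> _ [p pb <-]; exact: pc.
Qed.

Lemma smooth_norm_le_norm z : smooth_norm z <= `|z|.
Proof. by apply: smooth_norm_le => p; exact: penalized_le. Qed.

(** Separation applied to the ray opposite to (z, |z|). *)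
Lemma norming_functional z : exists2 p, dual_ball p & p z = `|z|.
Proof.
pose E := [set a : X * R | exists2 t : R, 0 <= t & a = (- (t *: z), - (t * `|z|))].
have [||||p [pb pE]] := @hahn_banach_sandwich R X 1 E ler01.
- by exists 0 => //; rewrite scale0r mul0r !oppr0.
- move=> _ _ [t t0 ->] [u u0 ->]; exists (t + u); first exact: addr_ge0.
  by rewrite /= -!opprD -scalerDl -mulrDl.
- move=> s _ s0 [t t0 ->]; exists (s * t); first by rewrite mulr_ge0 // ltW.
  by rewrite /= scalerN scalerA mulrN mulrA.
- by move=> _ [t t0 ->]; rewrite /= normrN normrZ mul1r ger0_norm.
have pb' : dual_ball (p : X -> R).
  by split=> [a u v|w]; [exact: linearP|have := pb w; rewrite mul1r].
exists (p : X -> R) => //.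
have /pE /= : E (- z, - `|z|) by exists 1; rewrite ?ler01 ?scale1r ?mul1r.
have := pb z; have := ler_norm (p z : R); rewrite raddfN mul1r /=.
by move=> a b c; apply/eqP; rewrite eq_le; apply/andP; split; lra.
Qed.

Lemma smooth_norm_ge z : `|z| - 4 * eta <= smooth_norm z.
Proof.
have [p pb pz] := norming_functional z.
apply: le_trans (le_smooth_norm z pb).
rewrite /penalized pz; have := ler_wpM2l (ltW eta0) (penalty_le4 pb); lra.
Qed.

Lemma smooth_norm_lipschitz z w : smooth_norm z - smooth_norm w <= `|z - w|.
Proof.
rewrite lerBlDr; apply: smooth_norm_le => p pb.
have := le_smooth_norm w pb; have [_ /(_ (z - w))] := pb.
have := ler_norm (p (z - w)); rewrite (dual_ballB _ _ pb) /penalized; lra.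
Qed.

(** A pointwise limit of maximizing functionals along an ultrafilter is a
maximizer: the ball is closed under pointwise limits, and the distances to
q k, hence the penalty, are lower semicontinuous for them. *)
Lemma penalized_maximizer z : exists2 p, dual_ball p & penalized z p = smooth_norm z.
Proof.
pose F := filter_from [set b : R | 0 < b]
  (fun b => [set p | dual_ball p /\ smooth_norm z - b <= penalized z p]).
have FF : Filter F.
  apply: filter_from_filter; first by exists 1; rewrite /= ltr01.
  move=> i j /= i0 j0; exists (Num.min i j); first by rewrite /= lt_min i0.
  move=> p [pb pz]; split; split=> //; apply: le_trans pz;
    by rewrite lerD2l lerN2 ge_min lexx ?orbT.
have PF : ProperFilter F.
  apply: filter_from_proper => b /= b0.
  have [_ [p pb <-] pz] := sup_adherent b0 (smooth_has_sup z).
  by exists p; split=> //; exact: ltW.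
have [G [UG FG]] := ultraFilterLemma PF.
have GB : \forall p \near G, dual_ball p.
  by apply: FG; exists 1 => /=; [exact: ltr01|move=> p []].
(* Values at y stay in a compact interval, and an ultrafilter converges to its
   cluster points. *)
have lim y : exists l : R, (fun p : X -> R => p y) @ G --> l.
  have cK : compact `[- `|y|, `|y|] by exact: segment_compact.
  have [|l [_ cl]] := cK ((fun p : X -> R => p y) @ G) _.
    apply: filterS GB => p [_ /(_ y)]; rewrite /= in_itv /= => py.
    by have := ler_norm (p y); have := ler_norm (- p y); rewrite normrN; lra.
  exists l => A nA; rewrite /fmap /nbhs /=.
  have [//|GA] := in_ultra_setVsetC ((fun p : X -> R => p y) @^-1` A) UG.
  by have [t [/= nAt /nAt]] := cl (~` A) A GA nA.
pose P y := xget (0 : R) [set l | (fun p : X -> R => p y) @ G --> l].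
have Plim y : (fun p : X -> R => p y) @ G --> P y.
  exact: (xgetPex (0 : R) (lim y)).
have PB : dual_ball P.
  split=> [a u v|y].
    apply: (@cvg_unique _ (@norm_hausdorff _ _)
      ((fun p : X -> R => p (a *: u + v)) @ G)); first exact: Plim.
    apply: (@cvg_trans _ ((fun p : X -> R => a * p u + p v) @ G)).
      apply: near_eq_cvg; apply: filterS GB => p [pl _]; exact/esym.
    by apply: cvgD; [apply: cvgMr|]; exact: Plim.
  have cl : closed [set t : R | `|t| <= `|y|].
    have -> : [set t : R | `|t| <= `|y|] = closed_ball_ Num.norm 0 `|y|.
      by apply/seteqP; split=> t; rewrite /closed_ball_ /= sub0r normrN.
    exact: closed_closed_ball_.
  apply: (closed_cvg _ cl _ _ (Plim y)).
  by apply: filterS GB => p [_ /(_ y)].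
exists P => //; apply/eqP; rewrite eq_le le_smooth_norm //=.
have dlim k e : 0 < e ->
    \forall p \near G, dual_dist Y P (q k) - e <= dual_dist Y p (q k).
  move=> e0; have e2 : 0 < e / 2 by rewrite divr_gt0.
  have [_ [y [Yy y1] <-] yP] := sup_adherent e2 (dual_dist_has_sup Ysub PB (qball k)).
  have near_y : \forall p \near G, `|P y - p y| < e / 2.
    by move/cvgrPdist_lt : (Plim y); apply.
  apply: filterS2 GB near_y => p pb pP.
  have := le_dual_dist Ysub pb (qball k) Yy y1; move: yP; rewrite -/(dual_dist Y P (q k)).
  have := ler_normD (P y - p y) (p y - q k y); rewrite addrA subrK; lra.
have slim n e : 0 < e -> \forall p \near G, penalty_sum n P - e <= penalty_sum n p.
  move=> e0; suff : \forall p \near G,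
      penalty_sum n P - e * (1 - 2^-1 ^+ n) <= penalty_sum n p.
    apply: filterS => p; have := mulr_gt0 e0 (h n); lra.
  elim: n => [|n IH].
    by apply: filterS GB => p pb; rewrite /penalty_sum !big_ord0 expr0 subrr mulr0 subr0.
  have e4 : 0 < e / 4 by rewrite divr_gt0.
  apply: filterS3 GB IH (dlim n _ e4) => p pb IH d.
  rewrite !penalty_sumS.
  have d2 := dual_dist_le2 Ysub PB (qball n).
  have d2' := dual_dist_le2 Ysub pb (qball n).
  have d0 := dual_dist_ge0 Ysub pb (qball n).
  have d0' := dual_dist_ge0 Ysub PB (qball n).
  have : dual_dist Y P (q n) ^+ 2 - e <= dual_dist Y p (q n) ^+ 2 by rewrite !expr2; nra.
  move=> /(ler_wpM2l (ltW (h n.+1))); rewrite [2^-1 ^+ n.+1]exprS; lra.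
suff penaltyP : eta * penalty P <= P z - smooth_norm z by rewrite /penalized; lra.
rewrite mulrC -ler_pdivlMr //; apply: penalty_le => n; rewrite ler_pdivlMr //.
apply/ler_addgt0Pr => e e0.
have c0 : 0 < e / (eta + 2) by rewrite divr_gt0 // ltr_wpDl // ltW.
set c := e / (eta + 2) in c0.
have Gc : \forall p \near G, dual_ball p /\ smooth_norm z - c <= penalized z p.
  by apply: FG; exists c.
have Gz : \forall p \near G, `|P z - p z| < c.
  by move/cvgrPdist_lt : (Plim z); apply.
have [p [[pb pz] [pP ps]]] := filter_ex (filterI Gc (filterI Gz (slim n _ c0))).
have := ler_wpM2l (ltW eta0) (le_trans ps (le_penalty n pb)).
have := ler_norm (p z - P z); rewrite distrC; move: pz; rewrite /penalized.
have ec : e = c * (eta + 2) by rewrite /c divfK // gt_eqF // ltr_wpDl // ltW.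
lra.
Qed.

(** Let r be nearly maximizing.  By [penalty_midpoint] the midpoint of p and r
would do better than p unless r and p are at nearly equal distance from each
q n; taking q n close to p shows that r is close to p. *)
Lemma penalized_maximizer_stable z p e : dual_ball p ->
  penalized z p = smooth_norm z -> 0 < e ->
  exists2 b, 0 < b & forall r, dual_ball r ->
    smooth_norm z - b <= penalized z r -> dual_dist Y r p <= e.
Proof.
move=> pb pz e0; have e4 : 0 < e / 4 by rewrite divr_gt0.
have [n pn] := qdense pb e4.
have w0 := mulr_gt0 eta0 (h n.+1).
exists (2 * (eta * 2^-1 ^+ n.+1 * (e / 4) ^+ 2)).
  by rewrite mulr_gt0 // mulr_gt0 // exprn_gt0.
move=> r rb rz.
have rn : dual_dist Y r (q n) <= dual_dist Y p (q n) + e / 2.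
  rewrite leNgt; apply/negP => far.
  have := ler_wpM2l (ltW eta0) (penalty_midpoint n rb pb).
  have := le_smooth_norm z (dual_ball_mid rb pb).
  move: pz rz; rewrite /penalized => pz rz mid gap.
  have sq : (e / 4) ^+ 2 < ((dual_dist Y r (q n) - dual_dist Y p (q n)) / 2) ^+ 2.
    by rewrite !expr2; nra.
  rewrite -(ltr_pM2l w0) in sq; rewrite mulrDr mulrA in gap; lra.
have := dual_dist_triangle Ysub rb (qball n) pb.
by rewrite (dual_dist_sym Y (q n) p); lra.
Qed.

(** The maximizer p at z is the superdifferential: a near maximizer at z + v is
also nearly maximizing at z, hence close to p on Y by
[penalized_maximizer_stable], and it bounds the increment. *)
Lemma smooth_norm_superdiff z : exists2 p, dual_ball p &
  forall e, 0 < e -> exists2 s, 0 < s & forall v, Y v -> `|v| < s ->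
    smooth_norm (z + v) <= smooth_norm z + p v + e * `|v|.
Proof.
have [p pb pz] := penalized_maximizer z; exists p => // e e0.
have e2 : 0 < e / 2 by rewrite divr_gt0.
have [b b0 stable] := penalized_maximizer_stable pb pz e2.
have d0 : 0 < 2 + e / 2 by rewrite addr_gt0.
exists (b / (2 + e / 2)); first by rewrite divr_gt0.
move=> v Yv; rewrite ltr_pdivlMr // => vb.
have [->|v0] := eqVneq v 0.
  by rewrite addr0 (dual_ball_0 pb) normr0 mulr0 !addr0.
have t0 : 0 < e / 2 * `|v| by rewrite mulr_gt0 // normr_gt0.
have [_ [r rb <-] rv] := sup_adherent t0 (smooth_has_sup (z + v)).
move: rv; rewrite -/(smooth_norm (z + v)) /penalized (dual_ballD _ _ rb) => rv.
have rv1 : `|r v| <= `|v| by case: rb.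
have := smooth_norm_lipschitz z (z + v); rewrite opprD addrA subrr add0r normrN => lip.
have rz : smooth_norm z - b <= penalized z r.
  by rewrite /penalized; have := ler_norm (r v); lra.
have := le_smooth_norm z rb; rewrite /penalized.
have := dual_distM Ysub rb pb Yv; have := ler_norm (r v - p v).
have := ler_wpM2r (normr_ge0 v) (stable r rb rz); lra.
Qed.

End smooth_norm.

Lemma smooth_norm_exists (R : realType) (X : normedModType R) (Y : set X) (eta : R) :
  linear_subspace Y -> separable_dual_on Y -> 0 < eta ->
  exists phi : X -> R,
    [/\ forall z, `|z| - eta <= phi z <= `|z|,
        forall z w, phi z - phi w <= `|z - w| &
        forall z, exists2 p, dual_ball p &
          forall e, 0 < e -> exists2 s, 0 < s & forall v, Y v -> `|v| < s ->
            phi (z + v) <= phi z + p v + e * `|v|].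
Proof.
move=> Ysub Ysep eta0; have [q [qball qdense]] := dual_ball_dense Ysub Ysep.
have eta4 : 0 < eta / 4 by rewrite divr_gt0.
exists (smooth_norm Y q (eta / 4)); split.
- move=> z; rewrite smooth_norm_le_norm // andbT.
  have := smooth_norm_ge Ysub qball eta4 z; lra.
- by move=> z w; apply: smooth_norm_lipschitz.
- by move=> z; apply: smooth_norm_superdiff.
Qed.

(** * Separable reduction *)

Section separable_closure.

Lemma countable_closure (T : Type) (J : countType) (op : J -> T -> T -> T) (x : T) :
  exists C : set T, [/\ countable C, C x & forall j u v, C u -> C v -> C (op j u v)].
Proof.
(* The elements generated by x and the operations, as values of terms. *)
pose ev := fix ev (t : GenTree.tree J) : T :=
  match t with
  | GenTree.Node _ [:: GenTree.Leaf j; a; b] => op j (ev a) (ev b)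
  | _ => x
  end.
exists (range ev); split.
- exact: card_le_trans (card_image_le _ _) (countableP _).
- by exists (GenTree.Node 0 [::]).
- by move=> j _ _ [a _ <-] [b _ <-]; exists (GenTree.Node 0 [:: GenTree.Leaf j; a; b]).
Qed.

Context (R : realType) (X : normedModType R).

Lemma closure_normP (C : set X) x :
  closure C x <-> forall e : R, 0 < e -> exists2 y, C y & `|x - y| < e.
Proof.
split=> [Cx e e0|Cx U /nbhs_ballP[e /= e0 eU]].
  have [y [Cy]] := Cx _ (nbhsx_ballx x e e0).
  by rewrite -ball_normE /= => ?; exists y.
have [y Cy xy] := Cx e e0; exists y; split=> //; apply: eU.
by rewrite -ball_normE.
Qed.

Lemma rat_near (a e : R) : 0 < e -> exists q : rat, a < ratr q < a + e.
Proof.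
move=> e0; have : a < a + e by rewrite ltrDl.
by move=> /rat_in_itvoo[q]; rewrite in_itv /= => aq; exists q.
Qed.

Lemma seq_lower_bound (T : eqType) (l : seq T) (g : T -> R) :
  (forall a, a \in l -> 0 < g a) -> exists2 t, 0 < t & forall a, a \in l -> t <= g a.
Proof.
elim: l => [_|b l IH gl]; first by exists 1.
have [a al|t t0 tl] := IH; first by apply: gl; rewrite inE al orbT.
exists (Num.min t (g b)); first by rewrite lt_min t0 gl // mem_head.
move=> a; rewrite inE => /predU1P[->|al]; first by rewrite ge_min lexx orbT.
by rewrite ge_min tl.
Qed.

Lemma small_inv (t : R) : 0 < t -> exists k : nat, (k.+1%:R^-1 : R) < t.
Proof.
by move=> t0; have [k _ /(_ k (leqnn k))] := near_infty_natSinv_lt (PosNum t0); exists k.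
Qed.
Lemma closure_linear_subspace (C : set X) : C !=set0 ->
  (forall (q : rat) u v, C u -> C v -> C (ratr q *: u + v)) ->
  linear_subspace (closure C).
Proof.
move=> [u0 Cu0] CZ; split.
  apply: subset_closure; have := CZ (-1) u0 u0 Cu0 Cu0.
  by rewrite rmorphN rmorph1 scaleN1r addNr.
move=> a u v /closure_normP Cu /closure_normP Cv; apply/closure_normP => e e0.
have k0 : 0 < `|u| + `|a| + 3 by rewrite ltr_wpDl // addr_ge0.
pose d := Num.min 1 (e / (`|u| + `|a| + 3)).
have d0 : 0 < d by rewrite lt_min ltr01 divr_gt0.
have d1 : d <= 1 by rewrite ge_min lexx.
have de : d * (`|u| + `|a| + 3) <= e by rewrite -ler_pdivlMr // ge_min lexx orbT.
have [q /andP[aq qa]] := rat_near a d0.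
have [u' Cu' uu'] := Cu d d0; have [v' Cv' vv'] := Cv d d0.
exists (ratr q *: u' + v'); first exact: CZ.
have -> : a *: u + v - (ratr q *: u' + v') =
    (a - ratr q) *: u + ratr q *: (u - u') + (v - v').
  rewrite scalerBl scalerBr opprD addrACA; congr (_ + _).
  by rewrite addrA subrK.
apply: le_lt_trans (ler_normD _ _) _.
have := ler_normD ((a - ratr q) *: u) (ratr q *: (u - u')).
rewrite (normrZ (a - ratr q)) (normrZ (ratr q)) => n1.
have qa1 : `|a - ratr q| <= d by rewrite ler_norml; apply/andP; split; lra.
have q1 : `|ratr q| <= `|a| + 1 :> R.
  rewrite ler_norml; have := ler_norm a; have := ler_norm (- a); rewrite normrN.
  by move=> ? ?; apply/andP; split; lra.
have := ler_wpM2r (normr_ge0 u) qa1.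
have : `|ratr q : R| * `|u - u'| <= (`|a| + 1) * d by apply: ler_pM => //; exact: ltW.
lra.
Qed.

End separable_closure.

Section families.
Context (R : realType) (X : normedModType R).
Context (A : set X) (F : X -> R) (c : R) (e : nat -> R).
Hypothesis c0 : 0 <= c.
Hypothesis e0 : forall n, 0 <= e n.
Implicit Types (l : seq (rat * nat * X)) (pat : seq (rat * nat)) (x : X) (s : nat -> R).

(** A family consists of triples of a nonnegative weight, an index n and a point y.
If a functional p of norm at most c satisfies
p (y - x) <= F y - F x + e n * |y - x| for the points of a family, then
[family_gap (F x) x l] is nonnegative.  The reference value r replaces F x in
[family_cost] because the base point and its value are approximated
separately, F not being continuous.  Weights and indices range over countable
sets, as separable reduction requires. *)
Definition family_sum x l : X := \sum_(a <- l) ratr a.1.1 *: (a.2 - x).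

Definition family_cost (r : R) x l : R :=
  \sum_(a <- l) ratr a.1.1 * (F a.2 - r + e a.1.2 * `|a.2 - x|).

Definition family_gap r x l : R := family_cost r x l + c * `|family_sum x l|.

Definition admissible s x l : Prop :=
  forall a, a \in l -> [/\ 0 <= a.1.1, A a.2 & `|a.2 - x| < s a.1.2].

(** A Lipschitz constant of the gap in the base point and the reference value; it
depends only on the weights and indices. *)
Definition family_lip pat : R := \sum_(a <- pat) ratr a.1 * (1 + e a.2 + c).

Lemma family_gap_perturb l (r r' t : R) x x' :
  (forall a, a \in l -> 0 <= a.1.1) -> `|r - r'| <= t -> `|x - x'| <= t ->
  family_gap r x l <= family_gap r' x' l + family_lip (unzip1 l) * t.
Proof.
move=> l0 rt xt.
have lR a : a \in l -> (0 : R) <= ratr a.1.1 by move=> /l0; rewrite ler0q.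
pose w := \sum_(a <- l) (ratr a.1.1 : R).
pose v := \sum_(a <- l) (ratr a.1.1 * e a.1.2 : R).
have lipE : family_lip (unzip1 l) = w + v + c * w.
  rewrite /family_lip big_map /w /v mulr_sumr -!big_split /=.
  by apply: eq_bigr => a _; ring.
have w0 : 0 <= w by rewrite /w big_seq; apply: sumr_ge0.
have costE : family_cost r x l <= family_cost r' x' l + (w + v) * t.
  rewrite /family_cost /w /v -big_split mulr_suml -big_split /=.
  rewrite big_seq [leRHS]big_seq; apply: ler_sum => a /lR la.
  have : F a.2 - r + e a.1.2 * `|a.2 - x| <=
      F a.2 - r' + e a.1.2 * `|a.2 - x'| + t + e a.1.2 * t.
    have := ler_norm (r' - r); rewrite distrC => rr.
    have n1 : `|a.2 - x| <= `|a.2 - x'| + t.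
      have := ler_normD (a.2 - x') (x' - x); rewrite addrA subrK (distrC x' x); lra.
    have := ler_wpM2l (e0 a.1.2) n1; lra.
  move=> /(ler_wpM2l la); lra.
have sumE : `|family_sum x l| <= `|family_sum x' l| + w * t.
  have -> : family_sum x l = family_sum x' l + w *: (x' - x).
    rewrite /family_sum /w scaler_suml -big_split /=; apply: eq_bigr => a _.
    by rewrite -scalerDr addrA subrK.
  apply: le_trans (ler_normD _ _) _; rewrite lerD2l normrZ ger0_norm //.
  by rewrite distrC ler_wpM2l.
have := ler_wpM2l c0 sumE; rewrite lipE /family_gap; lra.
Qed.

(* The pattern j lists weights and indices, inverse radii for these indices, an
   inverse margin and a reference value; ys are the points of a family with this
   pattern whose gap is negative by more than the margin. *)
Let violates (j : seq (rat * nat) * seq nat * nat * rat) x : set (seq X) :=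
  [set ys | [/\ size ys = size j.1.1.1,
    admissible (fun n => (nth 0%N j.1.1.2 n).+1%:R^-1) x (zip j.1.1.1 ys) &
    family_gap (ratr j.2) x (zip j.1.1.1 ys) < - (j.1.2.+1%:R^-1)]].

(** Y is the closure of a countable set C that contains, for each pattern and each
base point in C, the points of a violating family if there is one.  Suppose
that some family violates the inequalities at x in Y.  With a margin, the same
points violate them at some x' in C near x and for a rational reference value
near F x; so there are violating points in C, and these still violate the
inequalities at x, at the price of doubling the radii. *)
Lemma separable_reduction x0 : exists Y : set X,
  [/\ linear_subspace Y, separable_set Y, closed Y, Y x0 &
    forall x s, Y x -> (forall n, 0 < s n) ->
      (forall l, admissible s x l -> (forall a, a \in l -> Y a.2) ->
        0 <= family_gap (F x) x l) ->
      exists2 s', (forall n, 0 < s' n) &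
        forall l, admissible s' x l -> 0 <= family_gap (F x) x l].
Proof.
pose sel j x := xget [::] (violates j x).
pose J : countType := (rat + (seq (rat * nat) * seq nat * nat * rat) * nat)%type.
pose op (j : J) u v := match j with
  | inl q => ratr q *: u + v
  | inr (j, i) => nth 0 (sel j u) i end.
have [C [cC Cx0 Cop]] := countable_closure op x0.
have Csub : linear_subspace (closure C).
  apply: closure_linear_subspace; first by exists x0.
  by move=> q u v; apply: (Cop (inl q)).
exists (closure C); split=> //.
- by exists C; split=> //; exact: subset_closure.
- exact: closed_closure.
- exact: subset_closure.
move=> x s Yx s0 gapY.
have /boolp.choice[m ms] : forall n, exists k : nat, 2 * (k.+1%:R^-1 : R) <= s n.
  move=> n; have s2 : 0 < s n / 2 by rewrite divr_gt0.
  have [k ks] := small_inv s2; exists k.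
  by rewrite mulrC -ler_pdivlMr // ltW.
have m0 n : (0 : R) < (m n).+1%:R^-1 by rewrite invr_gt0.
exists (fun n => (m n).+1%:R^-1) => // l ladm.
rewrite leNgt; apply/negP => gneg.
pose g := - family_gap (F x) x l.
have g2 : 0 < g / 2 by rewrite divr_gt0 // oppr_gt0.
have [k kg] := small_inv g2.
pose K := family_lip (unzip1 l).
have K0 : 0 <= K.
  rewrite /K /family_lip big_map big_seq; apply: sumr_ge0 => a /ladm[a0 _ _].
  by rewrite mulr_ge0 ?ler0q // addr_ge0 // addr_ge0.
have [t1 t10 t1l] : exists2 t, 0 < t & forall a, a \in l ->
    t <= Num.min ((m a.1.2).+1%:R^-1 - `|a.2 - x|) ((m a.1.2).+1%:R^-1).
  apply: seq_lower_bound => a /ladm[_ _ al].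
  by rewrite lt_min m0 subr_gt0 al.
have kk0 : (0 : R) < k.+1%:R^-1 by rewrite invr_gt0.
(* How far x' may be from x: [t1] preserves the radii, and the second bound
   keeps the change of the gap below the margin. *)
pose t := Num.min t1 (k.+1%:R^-1 / (K + 1)).
have K1 : 0 < K + 1 by rewrite ltr_wpDl.
have t0 : 0 < t by rewrite lt_min t10 divr_gt0.
have Kt : K * t <= k.+1%:R^-1.
  apply: (@le_trans _ _ ((K + 1) * t)); first by rewrite ler_wpM2r ?(ltW t0) // lerDl.
  by rewrite mulrC -ler_pdivlMr // ge_min lexx orbT.
have tt1 : t <= t1 by rewrite ge_min lexx.
have [x' Cx' xx'] := (closure_normP C x).1 Yx t t0.
have [r /andP[r1 r2]] := rat_near (F x) t0.
have rF : `|ratr r - F x| <= t by rewrite ler_norml; apply/andP; split; lra.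
pose N := (\max_(a <- l) a.1.2).+1.
pose j := (unzip1 l, mkseq m N, k, r).
have lN a : a \in l -> nth 0%N (mkseq m N) a.1.2 = m a.1.2.
  move=> al; rewrite nth_mkseq // ltnS.
  by apply: (@leq_bigmax_seq _ l xpredT (fun a => a.1.2)).
have [szs sadm sgap] : violates j x' (sel j x').
  apply: xgetPex; exists (unzip2 l); rewrite /violates /= zip_unzip; split.
  - by rewrite !size_map.
  - move=> a al; have [a0 Aa ax] := ladm a al; split=> //; rewrite lN //.
    have := t1l a al; rewrite le_min => /andP[ta _].
    have := ler_normD (a.2 - x) (x - x'); rewrite addrA subrK.
    move: ta ax xx' tt1; move: ((m a.1.2).+1%:R^-1 : R) => y; lra.
  - have := @family_gap_perturb l (ratr r) (F x) t x' x _ rF _.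
    rewrite -/K (distrC x').
    move=> /(_ (fun a al => let: And3 a0 _ _ := ladm a al in a0) (ltW xx')).
    by move: kg Kt; rewrite /g; move: (k.+1%:R^-1 : R) => y; lra.
set ys := sel j x' in szs sadm sgap.
pose l' := zip (unzip1 l) ys.
have l'1 : unzip1 l' = unzip1 l by rewrite unzip1_zip // szs.
have l'mem a : a \in l' -> exists2 b, b \in l & b.1 = a.1.
  move=> al; have : a.1 \in unzip1 l by rewrite -l'1; apply: map_f.
  by move=> /mapP[b bl ->]; exists b.
have gl' : 0 <= family_gap (F x) x l'.
  apply: gapY.
    move=> a al; have [a0 Aa ax] := sadm a al; split=> //.
    have [b bl ba] := l'mem a al; move: ax; rewrite -ba /= lN // => ax.
    have := t1l b bl; rewrite le_min => /andP[_ tb]; have := ms b.1.2.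
    have := ler_normD (a.2 - x') (x' - x); rewrite addrA subrK (distrC x').
    by move: tb ax xx' tt1; move: ((m b.1.2).+1%:R^-1 : R) => y; lra.
  move=> a al; apply: subset_closure.
  have : a.2 \in ys by rewrite -(@unzip2_zip _ _ (unzip1 l) ys) ?szs // map_f.
  move=> /(nthP 0)[i _ <-]; exact: (Cop (inr (j, i)) x' x').
have := @family_gap_perturb l' (F x) (ratr r) t x x' _ _ (ltW xx').
rewrite l'1 -/K distrC => /(_ (fun a al => let: And3 a0 _ _ := sadm a al in a0) rF).
move: Kt gl' sgap; rewrite -/l' /=; move: (k.+1%:R^-1 : R) => y; lra.
Qed.

End families.

(** * Approximate minimizers in Asplund spaces *)

Section functional_of_families.
Context (R : realType) (X : normedModType R).
Context (A : set X) (F : X -> R) (c : R) (e : nat -> R).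
Hypothesis c0 : 0 <= c.

(** Separation applied to the closed convex cone generated by the pairs
(y - x, F y - F x + e n * |y - x|).  Taking the closure makes it invariant
under real scalings although weights are rational. *)
Lemma functional_of_families (s : nat -> R) x :
  (forall l, admissible A s x l -> 0 <= family_gap F c e (F x) x l) ->
  exists p : {linear X -> R^o}, (forall z, `|p z : R| <= c * `|z|) /\
    forall n y, A y -> `|y - x| < s n -> (p (y - x) : R) <= F y - F x + e n * `|y - x|.
Proof.
move=> gap.
pose E := [set a : X * R | forall eps : R, 0 < eps -> exists l, [/\ admissible A s x l,
  `|a.1 - family_sum x l| <= eps & family_cost F e (F x) x l <= a.2 + eps]].
have [||||p [pc pE]] := @hahn_banach_sandwich R X c E c0.
- move=> eps eps0; exists [::]; split=> //.
    by rewrite /family_sum big_nil subrr normr0 ltW.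
  by rewrite /family_cost big_nil add0r ltW.
- move=> a b Ea Eb eps eps0; have eps2 : 0 < eps / 2 by rewrite divr_gt0.
  have [l [ladm lsum lcost]] := Ea _ eps2; have [m [madm msum mcost]] := Eb _ eps2.
  exists (l ++ m); split=> /=.
  + by move=> i; rewrite mem_cat => /orP[/ladm|/madm].
  + rewrite /family_sum big_cat /= -!/(family_sum _ _) opprD addrACA.
    apply: le_trans (ler_normD _ _) _; lra.
  + rewrite /family_cost big_cat /= -!/(family_cost _ _ _ _ _); lra.
- move=> t a t0 Ea eps eps0.
  have k0 : 0 < `|a.1| + `|a.2| + 1 by rewrite ltr_wpDl // addr_ge0.
  pose d := Num.min 1 (eps / 2 / (`|a.1| + `|a.2| + 1)).
  have d0 : 0 < d by rewrite lt_min ltr01 !divr_gt0.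
  have d1 : d <= 1 by rewrite ge_min lexx.
  have de : d * (`|a.1| + `|a.2| + 1) <= eps / 2.
    by rewrite -ler_pdivlMr // ge_min lexx orbT.
  have [q /andP[tq qt]] := rat_near t d0.
  have t1 : 0 < t + 1 by rewrite addr_gt0.
  have f0 : 0 < eps / 2 / (t + 1) by rewrite !divr_gt0.
  set f := eps / 2 / (t + 1) in f0.
  have ft : f * (t + 1) = eps / 2 by rewrite divfK // gt_eqF.
  have [l [ladm lsum lcost]] := Ea _ f0.
  have q0 : (0 : R) < ratr q by apply: lt_trans tq.
  exists [seq ((q * i.1.1, i.1.2), i.2) | i <- l]; split=> /=.
  + move=> _ /mapP[i /ladm[i0 Ai ix] ->]; split=> //=.
    by rewrite mulr_ge0 // -(ler0q R) ltW.
  + have -> : family_sum x [seq (q * i.1.1, i.1.2, i.2) | i <- l] =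
        ratr q *: family_sum x l.
      rewrite /family_sum big_map scaler_sumr; apply: eq_bigr => i _ /=.
      by rewrite rmorphM scalerA.
    have -> : t *: a.1 - ratr q *: family_sum x l =
        (t - ratr q) *: a.1 + ratr q *: (a.1 - family_sum x l).
      by rewrite scalerBl scalerBr addrA subrK.
    apply: le_trans (ler_normD _ _) _; rewrite (normrZ (t - ratr q)) (normrZ (ratr q)).
    rewrite (gtr0_norm q0) distrC gtr0_norm ?subr_gt0 //.
    have : (ratr q - t) * `|a.1| <= d * `|a.1| by rewrite ler_wpM2r //; lra.
    have : ratr q * `|a.1 - family_sum x l| <= (t + 1) * f.
      by apply: ler_pM => //; [exact: ltW|lra].
    have := mulr_ge0 (ltW d0) (normr_ge0 a.2); lra.
  + have -> : family_cost F e (F x) x [seq (q * i.1.1, i.1.2, i.2) | i <- l] =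
        ratr q * family_cost F e (F x) x l.
      rewrite /family_cost big_map mulr_sumr; apply: eq_bigr => i _ /=.
      by rewrite rmorphM mulrA.
    have := ler_wpM2l (ltW q0) lcost.
    have : (ratr q - t) * a.2 <= d * `|a.2|.
      apply: (@le_trans _ _ ((ratr q - t) * `|a.2|)).
        by rewrite ler_wpM2l ?ler_norm // subr_ge0 ltW.
      by rewrite ler_wpM2r //; lra.
    have : ratr q * f <= (t + 1) * f by rewrite ler_wpM2r ?(ltW f0) //; lra.
    have := mulr_ge0 (ltW d0) (normr_ge0 a.1); lra.
- move=> a Ea; apply/ler_addgt0Pr => eps eps0.
  have c1 : 0 < c + 1 by rewrite ltr_wpDl.
  have d0 : 0 < eps / (c + 1) by rewrite divr_gt0.
  set d := eps / (c + 1) in d0.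
  have dc : d * (c + 1) = eps by rewrite divfK // gt_eqF.
  have [l [ladm lsum lcost]] := Ea _ d0.
  have := gap l ladm; rewrite /family_gap.
  have : `|family_sum x l| <= `|a.1| + d.
    have := ler_normD a.1 (family_sum x l - a.1).
    rewrite [a.1 + _]addrC subrK distrC; lra.
  move=> /(ler_wpM2l c0); lra.
exists p; split=> // n y Ay yx; apply: (pE (y - x, _)) => eps eps0.
exists [:: (1, n, y)]; split.
- by move=> i; rewrite inE => /eqP ->.
- by rewrite /family_sum big_seq1 /= rmorph1 scale1r subrr normr0 ltW.
- by rewrite /family_cost big_seq1 /= rmorph1 mul1r lerDl ltW.
Qed.

End functional_of_families.

Section superdifferential.
Context (R : realType) (X : normedModType R) (Y : set X).
Implicit Types (G : X -> R) (p : X -> R).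

(** Frechet superdifferentiability relative to the directions in Y. *)
Definition superdiff_on G u p : Prop := forall eps, 0 < eps ->
  exists2 s, 0 < s & forall v, Y v -> `|v| < s -> G (u + v) <= G u + p v + eps * `|v|.

Lemma superdiff_onD G H u p q : superdiff_on G u p -> superdiff_on H u q ->
  superdiff_on (fun v => G v + H v) u (fun v => p v + q v).
Proof.
move=> Gp Hq eps eps0; have eps2 : 0 < eps / 2 by rewrite divr_gt0.
have [s s0 sP] := Gp _ eps2; have [t t0 tP] := Hq _ eps2.
exists (Num.min s t); first by rewrite lt_min s0.
move=> v Yv; rewrite lt_min => /andP[vs vt].
have := sP v Yv vs; have := tP v Yv vt; lra.
Qed.

Lemma superdiff_onZ (a : R) G u p : 0 < a -> superdiff_on G u p ->
  superdiff_on (fun v => a * G v) u (fun v => a * p v).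
Proof.
move=> a0 Gp eps eps0; have epsa : 0 < eps / a by rewrite divr_gt0.
have [s s0 sP] := Gp _ epsa; exists s => // v Yv vs.
have := ler_wpM2l (ltW a0) (sP v Yv vs).
have -> : a * (G u + p v + eps / a * `|v|) = a * G u + a * p v + eps * `|v|.
  by field; rewrite gt_eqF.
by [].
Qed.

Lemma superdiff_on_shift G u w p : superdiff_on G (u - w) p ->
  superdiff_on (fun v => G (v - w)) u p.
Proof.
move=> Gp eps /Gp[s s0 sP]; exists s => // v Yv vs.
by rewrite addrAC; exact: sP.
Qed.

End superdifferential.

Section banach_metric.
Context (R : realType) (X : completeNormedModType R).

Lemma banach_complete_metric : complete_metric (normed_metric X).
Proof.
move=> F PF cF; have : cvg (F : set_system X) by exact: cauchy_cvg.
by move=> /cvg_ex[l Fl]; exists l.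
Qed.

End banach_metric.

Section asplund_fuzzy.
Context (R : realType) (X : completeNormedModType R).

(** The point u is the perturbed minimizer of g restricted to Y plus
c0 phi0 (. - u0), where c1 < c0 < c2 and phi0 is a smooth approximate norm; as
u0 is a minimizer of g + c1 |. - u0|, it cannot be far from u0.  The
superdifferentials P n of the perturbed terms have norm below c2 and give the
inequalities of [separable_reduction] over Y; these carry over to X, where
[functional_of_families] turns them into a subgradient. *)
Lemma asplund_fuzzy (g : normed_metric X -> \bar R) (u0 : X) (c1 c2 rho : R) :
  asplund X -> lower_semicontinuous g -> (forall v, 0 <= g v)%E ->
  (g u0 < +oo)%E -> 0 <= c1 -> c1 < c2 -> 0 < rho ->
  (forall v : X, g u0 <= g v + (c1 * `|v - u0|)%:E)%E ->
  exists (u : X) (p : {linear X -> R^o}),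
    [/\ `|u - u0| < rho, (g u < g u0 + rho%:E)%E,
      forall z, `|p z : R| <= c2 * `|z| &
      forall eps : R, 0 < eps -> exists2 s : R, 0 < s & forall y : X, `|y - u| < s ->
        (g u + (p (y - u) : R)%:E <= g y + (eps * `|y - u|)%:E)%E].
Proof.
move=> aX lg g0 gu0 c10 c12 rho0 gmin.
pose delta := (c2 - c1) / 4.
have d0 : 0 < delta by rewrite divr_gt0 // subr_gt0.
pose c0 := c1 + 2 * delta.
have c00 : 0 < c0 by rewrite /c0; lra.
have c20 : 0 <= c2 by lra.
(* The Frechet error at index n: 2 ^ - n for the superdifferential of G n, and
   delta / 2 ^ n twice, for the remainders of the perturbation and of P. *)
pose e n : R := (1 + 2 * delta) * 2^-1 ^+ n.
have h0 n : (0 : R) < 2^-1 ^+ n by rewrite exprn_gt0 // invr_gt0.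
have e0 n : 0 <= e n by rewrite mulr_ge0 ?(ltW (h0 _)) //; lra.
pose F (v : X) := fine (g v).
pose A := [set v : X | (g v < +oo)%E].
have gF v : A v -> g v = (F v)%:E by move=> Av; rewrite fineK // ge0_fin_numE.
have [Y [Ysub Ysep Ycl Yu0 Yred]] := separable_reduction A F c20 e0 u0.
have Ydual := aX Y Ysub Ysep.
pose eta := Num.min rho (delta * rho) / (2 * c0).
have m0 : 0 < Num.min rho (delta * rho) by rewrite lt_min rho0 mulr_gt0.
have eta0 : 0 < eta by rewrite divr_gt0 // mulr_gt0.
have etaE : c0 * eta = Num.min rho (delta * rho) / 2.
  by rewrite /eta; field; rewrite gt_eqF.
have [phi0 [phi0n phi0l phi0d]] := smooth_norm_exists Ysub Ydual eta0.
have /boolp.choice[Phi PhiP] := fun k => smooth_norm_exists Ysub Ydual (h0 k).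
pose f (v : X) : \bar R := ((if v \in Y then g v else +oo) + (c0 * phi0 (v - u0))%:E)%E.
have lf : lower_semicontinuous (f : normed_metric X -> \bar R).
  apply: (@lsc_add_lipschitz R (normed_metric X) _ _ c0).
    exact: (@lsc_restrict R (normed_metric X)).
  move=> v w; rewrite -mulrBr ler_pM2l //; apply: le_trans (phi0l _ _) _.
  by rewrite opprB addrA subrK.
pose phi k (y v : X) : R := Phi k (v - y).
pose pert (y : nat -> X) n (v : X) : R :=
  @perturbation R (normed_metric X) delta phi y n v.
have [y [u [udom umin]]] : exists (y : nat -> X) (u : X), (f u < +oo)%E /\
    forall n (v : X), (f u + (pert y n u)%:E <=
      f v + (pert y n v + delta * 2^-1 ^+ n * `|v - u|)%:E)%E.
  apply: (@perturbed_minimum R (normed_metric X) f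
   (- (c0 * eta)) delta phi u0 (@banach_complete_metric R X) lf _ _ d0).
  - move=> v; rewrite /f -[leLHS]add0e; apply: leeD.
      by case: ifP => // _; exact: leey.
    rewrite lee_fin -mulrN ler_pM2l //.
    by have /andP[] := phi0n (v - u0); have := normr_ge0 (v - u0); lra.
  - by rewrite /f mem_set // lte_add_pinfty // ltry.
  - move=> k v w; have [pn _ _] := PhiP k; exact: (pn (w - v)).
  - move=> k z v w; have [_ pl _] := PhiP k; apply: le_trans (pl _ _) _.
    by rewrite opprB addrA subrK.
have [Yu gu] : Y u /\ A u.
  move: udom; rewrite /f; case: ifPn => [/set_mem Yu|_]; last by rewrite addye.
  by split=> //; move: udom; rewrite /A /=; case: (g u) => [r| |]; rewrite ?ltry ?addye.
have fE v : Y v -> A v -> f v = (F v + c0 * phi0 (v - u0))%:E.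
  by move=> Yv Av; rewrite /f mem_set // gF // EFinD.
pose G n (v : X) : R := c0 * phi0 (v - u0) + pert y n v.
have Gmin n v : Y v -> A v -> F u + G n u <= F v + G n v + delta * 2^-1 ^+ n * `|v - u|.
  move=> Yv Av; have := umin n v; rewrite !fE // -!EFinD lee_fin /G.
  by rewrite -!addrA.
(* The minimality of u, compared with u0, against that of u0. *)
have close : delta * `|u - u0| <= c0 * eta /\ F u <= F u0 + c0 * eta.
  have := Gmin 0%N u0 Yu0 gu0.
  rewrite /G /pert /perturbation !big_ord0 !addr0 expr0 mulr1.
  rewrite subrr distrC; have /andP[_] := phi0n 0; rewrite normr0 => p0.
  have /andP[pu _] := phi0n (u - u0).
  have := gmin u; rewrite (gF _ gu0) (gF _ gu) -EFinD lee_fin.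
  have := ler_wpM2l (ltW c00) p0; have := ler_wpM2l (ltW c00) pu.
  have := mulr_ge0 (ltW d0) (normr_ge0 (u - u0)).
  have := mulr_ge0 c10 (normr_ge0 (u - u0)).
  have : c0 * `|u - u0| = c1 * `|u - u0| + 2 * (delta * `|u - u0|) by rewrite /c0; ring.
  by move=> *; split; lra.
have [p0 p0b p0d] := phi0d (u - u0).
have /boolp.choice[q qP] : forall k, exists q, dual_ball q /\
    superdiff_on Y (Phi k) (u - y k) q.
  by move=> k; have [_ _ /(_ (u - y k))[q qb qd]] := PhiP k; exists q.
pose P n (v : X) : R := c0 * p0 v + \sum_(k < n) delta * 2^-1 ^+ k.+1 * q k v.
have PS n v : P n.+1 v = P n v + delta * 2^-1 ^+ n.+1 * q n v.
  by rewrite /P big_ord_recr addrA.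
have Gd n : superdiff_on Y (G n) u (P n).
  elim: n => [|n IH].
    move=> eps eps0; have [s s0 sP] := superdiff_onZ c00 (superdiff_on_shift p0d) eps0.
    exists s => // v Yv vs; rewrite /G /P /pert /perturbation !big_ord0 !addr0; exact: sP.
  have w0 : 0 < delta * 2^-1 ^+ n.+1 by rewrite mulr_gt0.
  have := superdiff_onD IH (superdiff_onZ w0 (superdiff_on_shift (proj2 (qP n)))).
  move=> sd eps eps0; have [s s0 sP] := sd eps eps0; exists s => // v Yv vs.
  have := sP v Yv vs; rewrite PS /G /pert !perturbationS /phi; lra.
have Plin n a v w : P n (a *: v + w) = a * P n v + P n w.
  elim: n => [|n IH]; first by rewrite /P !big_ord0 !addr0 (proj1 p0b); ring.
  by rewrite !PS IH (proj1 (proj1 (qP n))); ring.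
have Pbound n z : `|P n z| <= (c0 + delta * (1 - 2^-1 ^+ n)) * `|z|.
  elim: n => [|n IH].
    rewrite /P big_ord0 addr0 expr0 subrr mulr0 addr0 normrM gtr0_norm //.
    by rewrite ler_pM2l //; case: p0b.
  have w0 : 0 < delta * 2^-1 ^+ n.+1 by rewrite mulr_gt0.
  rewrite PS; apply: le_trans (ler_normD _ _) _; rewrite normrM (gtr0_norm w0).
  have [_ /(_ z)] := proj1 (qP n).
  move=> /(ler_wpM2l (ltW w0)); rewrite [2^-1 ^+ n.+1]exprS; lra.
have Ptail n m z : (n <= m)%N -> P n z - P m z <= delta * 2^-1 ^+ n * `|z|.
  move=> nm; suff : P n z - P m z <= delta * (2^-1 ^+ n - 2^-1 ^+ m) * `|z|.
    have := mulr_ge0 (ltW (mulr_gt0 d0 (h0 m))) (normr_ge0 z); lra.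
  elim: m nm => [|m IH].
    by rewrite leqn0 => /eqP ->; rewrite !subrr mulr0 mul0r.
  rewrite leq_eqVlt => /predU1P[->|]; first by rewrite !subrr mulr0 mul0r.
  rewrite ltnS => /IH {}IH; rewrite PS.
  have w0 : 0 < delta * 2^-1 ^+ m.+1 by rewrite mulr_gt0.
  have [_ /(_ z)] := proj1 (qP m).
  rewrite ler_norml => /andP[qz _]; have := ler_wpM2l (ltW w0) qz.
  rewrite [2^-1 ^+ m.+1]exprS; lra.
have /boolp.choice[s sP] : forall n, exists s, 0 < s /\ forall v, Y v -> `|v| < s ->
    G n (u + v) <= G n u + P n v + 2^-1 ^+ n * `|v|.
  by move=> n; have [s s0 sv] := Gd n _ (h0 n); exists s.
have s0 n : 0 < s n by case: (sP n).
have YB v : Y v -> Y (v - u).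
  by move=> Yv; have [_ Yl] := Ysub; rewrite addrC -scaleN1r; exact: Yl.
(* A single functional, P m, has to serve for all the indices n <= m of a
   finite family. *)
have key n m v : (n <= m)%N -> A v -> Y v -> `|v - u| < s n ->
    - P m (v - u) <= F v - F u + e n * `|v - u|.
  move=> nm Av Yv vs; have [_ /(_ _ (YB _ Yv) vs)] := sP n.
  rewrite addrC subrK; have := Gmin n v Yv Av; have := Ptail n m (v - u) nm.
  rewrite /e; lra.
have P0 n : P n 0 = 0 by have := Plin n 1 0 0; rewrite scaler0 addr0; lra.
have Psum n l : P n (family_sum u l) = \sum_(a <- l) ratr a.1.1 * P n (a.2 - u).
  rewrite /family_sum; elim: l => [|a l IH]; first by rewrite !big_nil.
  by rewrite !big_cons Plin IH.
have [s' s'0 gap] : exists2 s' : nat -> R, (forall n, 0 < s' n) &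
    forall l, admissible A s' u l -> 0 <= family_gap F c2 e (F u) u l.
  apply: (Yred u s Yu s0) => l ladm lY.
  pose N := \max_(a <- l) a.1.2.
  have : - P N (family_sum u l) <= family_cost F e (F u) u l.
    rewrite Psum -sumrN /family_cost big_seq [leRHS]big_seq.
    apply: ler_sum => a al; have [a0 Aa ax] := ladm a al.
    rewrite -mulrN ler_wpM2l ?ler0q //; apply: key => //; last exact: lY.
    by apply: (@leq_bigmax_seq _ l xpredT (fun a => a.1.2)).
  have := Pbound N (family_sum u l); rewrite /family_gap.
  have := ler_norm (P N (family_sum u l)).
  have : (c0 + delta * (1 - 2^-1 ^+ N)) * `|family_sum u l| <= c2 * `|family_sum u l|.
    rewrite ler_wpM2r //; have := mulr_gt0 d0 (h0 N).
    have : c2 = c1 + 4 * delta by rewrite /delta; field.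
    rewrite /c0; lra.
  lra.
have [p [pb pF]] := functional_of_families c20 gap.
have [close1 close2] := close.
have mr : Num.min rho (delta * rho) <= rho by rewrite ge_min lexx.
have mdr : Num.min rho (delta * rho) <= delta * rho by rewrite ge_min lexx orbT.
exists u, p; split=> //.
- by rewrite -(ltr_pM2l d0); lra.
- by rewrite (gF _ gu) (gF _ gu0) -EFinD lte_fin; lra.
- move=> eps eps0.
  have [n _ /(_ n (leqnn n)) en] := geometric_small (1 + 2 * delta) eps0.
  exists (s' n) => // v vs; have [Av|] := ltP (g v) +oo%E; last first.
    by rewrite leye_eq => /eqP ->; rewrite addye ?leey // -ltNye ltNyr.
  rewrite (gF _ Av) (gF _ gu) -!EFinD lee_fin.
  have := pF n v Av vs; have := ler_wpM2r (normr_ge0 (v - u)) (ltW en).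
  rewrite /e; lra.
Qed.

End asplund_fuzzy.

(** * Clarke subgradients *)

Section clarke.
Context (R : realType) (X : normedModType R).
Implicit Types (f : X -> \bar R) (x z : X).

Lemma linear_continuous_of_bound (p : {linear X -> R^o}) (c : R) :
  (forall z, `|p z : R| <= c * `|z|) -> continuous p.
Proof.
move=> pc x; apply/cvgrPdist_lt => e e0.
have c1 : 0 < `|c| + 1 by rewrite ltr_wpDl.
near=> y; rewrite -raddfB /=; apply: le_lt_trans (pc _) _.
apply: (@le_lt_trans _ _ ((`|c| + 1) * `|x - y|)).
  by rewrite ler_wpM2r //; have := ler_norm c; lra.
rewrite mulrC -ltr_pdivlMr //; near: y.
by apply: cvgr_dist_lt => //; rewrite divr_gt0.
Unshelve. all: by end_near.
Qed.

Definition clarke_quotient_limsup f x z (eps : R) : \bar R := (limf_esup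
    (fun q : (X * R) * R =>
      ereal_inf [set (f (q.1.1 + q.2 *: z')%R - q.1.2%:E) * (q.2^-1)%:E
                  | z' in [set z' | (`|z' - z| < eps)%R]])
    (clarke_filter f x))%E.

(** The upper limits increase as eps decreases, so their limit is their
supremum. *)
Lemma clarke_quotient_limsup_le f x z (eps : R) : 0 < eps ->
  (clarke_quotient_limsup f x z eps <= clarke_deriv f x z)%E.
Proof.
move=> eps0; pose h := clarke_quotient_limsup f x z.
have hmono : {in Interval (BRight 0) (BInfty R false) &, nonincreasing_fun h}.
  move=> d e _ _ de; apply: le_ereal_inf_tmp => _ [V FV <-].
  apply: (@le_trans _ _ (ereal_sup ((fun q : (X * R) * R =>
      ereal_inf [set ((f (q.1.1 + q.2 *: z')%R - q.1.2%:E) * (q.2^-1)%:E)%E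
                  | z' in [set z' | (`|z' - z| < e)%R]]) @` V))).
    by apply: ereal_inf_lbound; exists V.
  apply: ge_ereal_sup => _ [q Vq <-].
  apply: (@le_trans _ _ (ereal_inf
      [set ((f (q.1.1 + q.2 *: z')%R - q.1.2%:E) * (q.2^-1)%:E)%E
        | z' in [set z' | (`|z' - z| < d)%R]])).
    apply: le_ereal_inf => _ [z' /= zd <-]; exists z' => //.
    exact: lt_le_trans de.
  by apply: ereal_sup_ubound; exists q.
have := @nonincreasing_at_right_cvge R h 0 (BInfty R false) isT hmono.
move=> /(cvg_lim (@ereal_hausdorff R)); rewrite /clarke_deriv => ->.
by apply: ereal_sup_ubound; exists eps => //=; rewrite in_itv /= eps0.
Qed.

Lemma clarke_filterP f x (V : set ((X * R) * R)) : clarke_filter f x V ->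
  exists2 rho, 0 < rho & forall u a t, `|u - x| < rho -> `|a - fine (f x)| < rho ->
    0 < t < rho -> (f u <= a%:E)%E -> V ((u, a), t).
Proof.
move=> [[B C] [/= [[B1 B2] [/= nB1 nB2] B12] nC] BCV].
have /nbhs_ballP[r1 /= r10 b1] := nB1; have /nbhs_ballP[r2 /= r20 b2] := nB2.
have [r3 /= r30 b3] := nC.
exists (Num.min r1 (Num.min r2 r3)); first by rewrite !lt_min r10 r20.
move=> u a t; rewrite !lt_min => /andP[ux _] /and3P[_ ax _] /and3P[t0 _ /andP[_ tr]] fua.
apply: (BCV ((u, a), t)) => //; split=> /=.
  apply: B12; split=> /=; [apply: b1|apply: b2].
    by rewrite -ball_normE /= distrC.
  by rewrite -ball_normE /= distrC.
by apply: b3 => //=; rewrite sub0r normrN gtr0_norm.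
Qed.

(** Up to closure, the epigraph of the generalized derivative at x, that is, the
tangent cone of Clarke to the epigraph of f. *)
Definition clarke_epi f x : set (X * R) :=
  [set a : X * R | forall eps : R, 0 < eps -> exists2 rho : R, 0 < rho &
    forall (u : X) (b t : R), `|u - x| < rho -> `|b - fine (f x)| < rho -> 0 < t < rho ->
      (f u <= b%:E)%E ->
      exists2 z, `|z - a.1| < eps & (f (u + t *: z)%R <= (b + t * a.2)%:E)%E].

(** Convexity of the tangent cone of Clarke: moving first along a leads from a
point of the epigraph of f near (x, f x) to another such point, from which one
moves along b. *)
Lemma clarke_epiD f x a b : clarke_epi f x a -> clarke_epi f x b ->
  clarke_epi f x (a.1 + b.1, a.2 + b.2).
Proof.
move=> Ea Eb eps eps0.
have eps2 : 0 < eps / 2 by rewrite divr_gt0.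
pose eps1 := Num.min (eps / 2) 1.
have eps10 : 0 < eps1 by rewrite lt_min eps2 ltr01.
have [r2 r20 h2] := Eb _ eps2; have [r1 r10 h1] := Ea _ eps10.
have k0 : 0 < `|a.1| + `|a.2| + 2 by rewrite ltr_wpDl // addr_ge0.
pose rho := Num.min r1 (r2 / (`|a.1| + `|a.2| + 2)).
have rho0 : 0 < rho by rewrite lt_min r10 divr_gt0.
have rr1 : rho <= r1 by rewrite ge_min lexx.
have rr2 : rho * (`|a.1| + `|a.2| + 2) <= r2.
  by rewrite -ler_pdivlMr // ge_min lexx orbT.
exists rho => // u c t ux cx /andP[t0 tr] fuc.
have [|||z1 z1a f1] := h1 u c t _ _ _ fuc; try by apply: lt_le_trans rr1.
  by rewrite t0; apply: lt_le_trans rr1.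
have [] := h2 (u + t *: z1) (c + t * a.2) t _ _ _ f1.
- have z1n : `|z1| <= `|a.1| + 1.
    have := ler_normD (z1 - a.1) a.1; rewrite subrK.
    by move: z1a; rewrite lt_min => /andP[_]; lra.
  rewrite addrAC; apply: le_lt_trans (ler_normD _ _) _.
  rewrite normrZ gtr0_norm //.
  have : t * `|z1| <= rho * (`|a.1| + 1) by apply: ler_pM => //; exact: ltW.
  have := mulr_ge0 (ltW rho0) (normr_ge0 a.2); lra.
- rewrite addrAC; apply: le_lt_trans (ler_normD _ _) _.
  rewrite normrM (gtr0_norm t0).
  have := ler_wpM2r (normr_ge0 a.2) (ltW tr).
  have := mulr_ge0 (ltW rho0) (normr_ge0 a.1); lra.
- rewrite t0 /=; have := mulr_ge0 (ltW rho0) (normr_ge0 a.1).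
  have := mulr_ge0 (ltW rho0) (normr_ge0 a.2); lra.
move=> z2 z2b f2; exists (z1 + z2) => /=.
  rewrite opprD addrACA; apply: le_lt_trans (ler_normD _ _) _.
  by move: z1a; rewrite lt_min => /andP[z1a _]; lra.
by rewrite scalerDr addrA mulrDr addrA.
Qed.

Lemma clarke_epiZ f x (s : R) a : 0 < s -> clarke_epi f x a ->
  clarke_epi f x (s *: a.1, s * a.2).
Proof.
move=> s0 Ea eps eps0; have epss : 0 < eps / s by rewrite divr_gt0.
have [r r0 h] := Ea _ epss.
exists (Num.min r (r / s)); first by rewrite lt_min r0 divr_gt0.
move=> u b t; rewrite !lt_min => /andP[ux _] /andP[bx _] /and3P[t0 _ ts] fub.
have [|||z za fz] := h u b (t * s) _ _ _ fub => //.
  by rewrite mulr_gt0 //= -ltr_pdivlMr.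
exists (s *: z) => /=.
  by rewrite -scalerBr normrZ gtr0_norm // mulrC -ltr_pdivlMr.
by rewrite scalerA mulrA.
Qed.

(** Taking (x, f x) itself as base point in [clarke_epi], minimality bounds the
increment from below by - c t |z| with z close to the given direction. *)
Lemma clarke_epi_ge f x c : 0 <= c -> f x \is a fin_num ->
  (exists2 d : R, 0 < d & forall v, `|v - x| < d -> (f x <= f v + (c * `|v - x|)%:E)%E) ->
  forall a, clarke_epi f x a -> - (c * `|a.1|) <= a.2.
Proof.
move=> c0 fx [d d0 fmin] a Ea; apply/ler_addgt0Pr => eps eps0.
have c1 : 0 < c + 1 by rewrite ltr_wpDl.
pose e := eps / (c + 1).
have e0 : 0 < e by rewrite divr_gt0.
have ec : e * (c + 1) = eps by rewrite divfK // gt_eqF.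
have [rho rho0 h] := Ea _ e0.
have k0 : 0 < `|a.1| + e + 1 by rewrite addr_gt0 // ltr_wpDl.
pose t := Num.min (rho / 2) (d / (`|a.1| + e + 1)).
have t0 : 0 < t by rewrite lt_min !divr_gt0.
have tr : t < rho by rewrite gt_min; apply/orP; left; lra.
have td : t * (`|a.1| + e + 1) <= d by rewrite -ler_pdivlMr // ge_min lexx orbT.
have [||||z za fz] := h x (fine (f x)) t _ _ _ _.
- by rewrite subrr normr0.
- by rewrite subrr normr0.
- by rewrite t0.
- by rewrite fineK.
have zn : `|z| <= `|a.1| + e.
  by have := ler_normD (z - a.1) a.1; rewrite subrK; lra.
have tz : t * `|z| <= t * (`|a.1| + e) by rewrite ler_wpM2l // ltW.
have := fmin (x + t *: z); rewrite addrAC subrr add0r normrZ gtr0_norm //.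
have /[swap] /[apply] : t * `|z| < d by lra.
move=> fle; have : (f x <= (fine (f x) + t * a.2 + c * (t * `|z|))%:E)%E.
  by apply: le_trans fle _; rewrite EFinD leeD2r.
rewrite -{1}(fineK fx) lee_fin => le1.
have : 0 <= t * (a.2 + c * `|z|) by lra.
rewrite pmulr_rge0 // => le2.
have := ler_wpM2l c0 zn; lra.
Qed.

Lemma clarke_epi_of_lt f x z (r : R) : (forall u, f u != -oo%E) ->
  (clarke_deriv f x z < r%:E)%E -> clarke_epi f x (z, r).
Proof.
move=> fN dr eps eps0.
have := le_lt_trans (clarke_quotient_limsup_le f x z eps0) dr.
move=> /ereal_inf_lt[_ [V FV <-] Vr].
have [rho rho0 h] := clarke_filterP FV.
exists rho => // u b t ux bx t0r fub.
have Vq := h u b t ux bx t0r fub.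
have : (ereal_inf [set ((f (u + t *: z')%R - b%:E) * (t^-1)%:E)%E
    | z' in [set z' | (`|z' - z| < eps)%R]] < r%:E)%E.
  by apply: le_lt_trans Vr; apply: ereal_sup_ubound; exists (u, b, t).
move=> /ereal_inf_lt[_ [z' /= z'z <-] q]; exists z' => //.
have /andP[t0 _] := t0r.
move: q (fN (u + t *: z')%R); case: (f _) => [y| |] //.
  rewrite -EFinB -EFinM lte_fin ltr_pdivrMr // => q _.
  by rewrite lee_fin; lra.
by rewrite addye // gt0_mulye // lte_fin invr_gt0.
Qed.

(** The sum rule for f + c |. - x| at a minimum, in which the two subgradients are
found at once by separation. *)
Lemma clarke_subgradient_of_min f x c : (forall u, f u != -oo%E) -> 0 <= c ->
  (f x < +oo)%E ->
  (exists2 d : R, 0 < d & forall v, `|v - x| < d -> (f x <= f v + (c * `|v - x|)%:E)%E) ->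
  exists2 p, clarke_subdiff f x p & forall z, `|p z : R| <= c * `|z|.
Proof.
move=> fN c0 fx fmin.
have fxfin : f x \is a fin_num by rewrite fin_numE fN -ltey.
have E0 : clarke_epi f x (0, 0).
  move=> eps eps0; exists 1 => // u b t _ _ _ fub; exists 0 => /=.
    by rewrite subrr normr0.
  by rewrite scaler0 addr0 mulr0 addr0.
have [p [pc pE]] := hahn_banach_sandwich c0 E0 (@clarke_epiD f x)
  (@clarke_epiZ f x) (clarke_epi_ge c0 fxfin fmin).
exists p => //; split=> //; first exact: linear_continuous_of_bound pc.
move=> z; rewrite leNgt; apply/negP => dp.
have [r rp dr] : exists2 r : R, r < p z & (clarke_deriv f x z < r%:E)%E.
  move: dp; case: (clarke_deriv f x z) => [d| |] //.
    by rewrite lte_fin => /midf_lt[? ?]; exists ((d + p z) / 2); rewrite ?lte_fin.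
  by move=> _; exists ((p z : R) - 1); rewrite ?ltNyr //; lra.
by have := pE _ (clarke_epi_of_lt fN dr) => /=; rewrite leNgt rp.
Qed.

End clarke.

(** * Error bounds in metric spaces *)

Section error_bound_metric.
Context (R : realType) (X : metricType R).
Implicit Types (f : X -> \bar R) (x u v : X).
Local Open Scope ereal_scope.

Lemma le_dist_set x (S : set X) (r : R) : (forall v, S v -> (r <= mdist x v)%R) ->
  r%:E <= dist_set x S.
Proof. by move=> h; apply: le_ereal_inf_tmp => _ [v Sv <-]; rewrite lee_fin h. Qed.

Lemma dist_set_le x (S : set X) v : S v -> dist_set x S <= (mdist x v)%:E.
Proof. by move=> Sv; apply: ereal_inf_lbound; exists v. Qed.

Lemma dist_set_ge0 x (S : set X) : 0 <= dist_set x S.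
Proof. by apply: le_dist_set => v _; exact: mdist_ge0. Qed.

(** The bound on the sublevel set S gives f x / n <= d(x, S), while the error bound
gives tau d(x, S) <= f x. *)
Lemma error_bound_rate f (tau n : R) x : (0 < tau)%R -> (0 < n)%R -> 0 < f x ->
  f x < +oo -> (forall u, sublevel0 f u -> f x <= (n * mdist x u)%:E) ->
  error_bound f tau x -> (tau <= n)%R.
Proof.
move=> tau0 n0 fx0 fx fS eb.
have fxf : f x \is a fin_num by rewrite fin_real // (lt_trans _ fx0) ?ltNyr.
have F0 : (0 < fine (f x))%R by rewrite -lte_fin fineK.
have : (fine (f x) / n)%:E <= dist_set x (sublevel0 f).
  apply: le_dist_set => v /fS; rewrite -{1}(fineK fxf) lee_fin => h.
  by rewrite ler_pdivrMr // mulrC.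
move=> /(lee_wpmul2l (ltW (tau0 : 0 < tau%:E))) => /le_trans/(_ eb).
rewrite -{2}(fineK fxf) -EFinM lee_fin mulrA ler_pdivrMr // mulrC ler_pM2l //.
Qed.

Lemma error_bound_nonlocal_slope f (tau : R) x : (0 < tau)%R -> 0 < f x ->
  error_bound f tau x -> tau%:E <= nonlocal_slope f x.
Proof.
move=> tau0 fx0 eb; rewrite /nonlocal_slope; case: ifPn => [fx|_]; last exact: leey.
set S := ereal_sup _; rewrite leNgt; apply/negP => lt.
have s0 : 0 <= maxe 0 S by rewrite le_max lexx.
have sf : maxe 0 S \is a fin_num by rewrite ge0_fin_numE // (lt_trans lt) ?ltry.
pose s := fine (maxe 0 S).
have sE : maxe 0 S = s%:E by rewrite fineK.
have s0' : (0 <= s)%R by rewrite -lee_fin -sE.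
have st : (s < tau)%R by rewrite -lte_fin -sE.
suff : (tau <= (s + tau) / 2)%R by lra.
apply: (error_bound_rate tau0 _ fx0 fx) eb; first lra.
move=> u fu.
have ux : u != x by apply/eqP => uxE; move: fu; rewrite /sublevel0 /= uxE leNgt fx0.
have d0 : (0 < mdist u x)%R by rewrite mdist_gt0.
have fxf : f x \is a fin_num by rewrite fin_real // (lt_trans _ fx0) ?ltNyr.
have : maxe 0 (f x - maxe (f u) 0) * ((mdist u x)^-1)%:E <= s%:E.
  rewrite -sE le_max; apply/orP; right; apply: ereal_sup_ubound.
  by exists u.
rewrite (max_idPr fu) sube0 (max_idPr (ltW fx0)) -(fineK fxf) -EFinM !lee_fin.
rewrite ler_pdivrMr // (metric_sym x u) => /le_trans; apply.
rewrite ler_pM2r //; lra.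
Qed.

Lemma lsc_positive_ball f u : lower_semicontinuous f -> 0 < f u ->
  exists2 r : R, (0 < r)%R & forall v, (mdist u v < r)%R -> 0 < f v.
Proof.
move=> lf fu; have [V /nbhs_ballP[r /= r0 rV] Vf] := lf _ _ fu.
by exists r => // v uv; apply: Vf; apply: rV; rewrite ballEmdist.
Qed.

(** Passing to the infimum over the sublevel set destroys strictness; the rate
sigma < tau restores it, the distance being at least r > 0.  An empty sublevel
set, at infinite distance, is covered. *)
Lemma lt_dist_sublevel f w (alpha tau sigma r : R) : (0 < sigma < tau)%R -> (0 < r)%R ->
  f w \is a fin_num ->
  (forall v, sublevel0 f v -> alpha%:E * f w <= (sigma * mdist w v)%:E) ->
  (forall v, sublevel0 f v -> (r <= mdist w v)%R) ->
  alpha%:E * f w < tau%:E * dist_set w (sublevel0 f).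
Proof.
move=> /andP[s0 st] r0 fw h hr.
have t0 : (0 < tau)%R by apply: lt_trans st.
have := le_dist_set hr.
have : (alpha * fine (f w) / sigma)%:E <= dist_set w (sublevel0 f).
  apply: le_dist_set => v /h; rewrite -{1}(fineK fw) -EFinM lee_fin => h'.
  by rewrite ler_pdivrMr // [leRHS]mulrC.
rewrite -{2}(fineK fw) -EFinM; case: (dist_set _ _) => [D| |] //.
  rewrite !lee_fin ler_pdivrMr // -EFinM lte_fin => a b.
  apply: le_lt_trans a _; rewrite mulrC ltr_pM2r //; exact: lt_le_trans b.
by move=> _ _; rewrite gt0_muley ?lte_fin // ltry.
Qed.

(** The principle of Ekeland for f_+ with constants between f x / (alpha d(x, S))
and tau / alpha, which exist because the error bound fails.  Being above the
former, they keep u within alpha d(x, S) of x. *)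
Lemma error_bound_failure f (alpha tau : R) x :
  complete_metric X -> lower_semicontinuous f -> 0 < f x -> (0 < tau)%R ->
  (0 < alpha <= 1)%R -> ~ error_bound f tau x ->
  exists u (c : R), [/\ (0 < c)%R /\ (alpha * c < tau)%R,
    f x < tau%:E * dist_set x (sublevel0 f), f u <= f x /\ 0 < f u,
    (mdist u x)%:E < alpha%:E * dist_set x (sublevel0 f) &
    forall v, maxe (f u) 0 <= maxe (f v) 0 + (c * mdist u v)%:E].
Proof.
move=> cX lf fx0 tau0 /andP[a0 a1] /negP; rewrite -ltNge => lt.
set D := dist_set _ _ in lt *.
have D0 : 0 <= D := dist_set_ge0 _ _.
have fx : f x < +oo by apply: lt_le_trans lt (leey _).
have fxf : f x \is a fin_num by rewrite fin_real // (lt_trans _ fx0) ?ltNyr.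
have F0 : (0 < fine (f x))%R by rewrite -lte_fin fineK.
set F := fine (f x) in F0.
have fE : f x = F%:E by rewrite fineK.
(* The case distinction is on d(x, S), which is infinite if S is empty; then
   any positive k below tau will do. *)
have [k [k0 kt kD]] : exists k : R, [/\ (0 < k)%R, (k < tau)%R & F%:E < k%:E * D].
  move: lt; rewrite fE; case: D D0 => [d| |] // d0.
    rewrite -EFinM lte_fin => Ftd.
    have d0' : (0 < d)%R.
      by rewrite -(pmulr_rgt0 _ tau0); apply: lt_trans Ftd.
    have Fd : (F / d < tau)%R by rewrite ltr_pdivrMr.
    have [k1 k2] := midf_lt Fd; exists ((F / d + tau) / 2)%R; split=> //.
      by apply: lt_trans k1; rewrite divr_gt0.
    by rewrite -EFinM lte_fin -ltr_pdivrMr.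
  move=> _; exists (tau / 2)%R; split; [lra|lra|].
  by rewrite gt0_muley ?ltry // lte_fin; lra.
pose K := (tau / alpha)%R; pose k' := (k / alpha)%R.
have k'0 : (0 < k')%R by rewrite divr_gt0.
have kK : (k' < K)%R by rewrite ltr_pM2r // invr_gt0.
pose delta := ((K - k') / 4)%R.
have delta0 : (0 < delta)%R by rewrite divr_gt0 // subr_gt0.
have c0 : (0 < k' + delta)%R by rewrite addr_gt0.
have lg := lsc_max0 lf.
have g0 v : 0 <= maxe (f v) 0 by rewrite le_max lexx orbT.
have gx : maxe (f x) 0 = f x by rewrite (max_idPl (ltW fx0)).
have [|u [ux umin]] := @ekeland R X _ x _ _ cX lg g0 _ c0 delta0; first by rewrite gx.
rewrite gx addrK in ux.
have kd : (k' * mdist u x)%:E <= F%:E.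
  by rewrite -fE; apply: le_trans ux; rewrite leeDr ?g0.
have dist : (mdist u x)%:E < alpha%:E * D.
  have := le_lt_trans kd kD; rewrite /k' in k'0 *.
  case: D D0 {lt kD} => [d| |] // d0.
    rewrite -!EFinM !lte_fin mulrAC ltr_pdivrMr // -mulrA ltr_pM2l //.
    by rewrite (mulrC d).
  by move=> _; rewrite gt0_muley ?ltry // lte_fin.
have fu0 : 0 < f u.
  rewrite ltNge; apply/negP => fu; have /= := @dist_set_le x (sublevel0 f) u fu.
  rewrite leNgt metric_sym -/D => /negP; apply; apply: lt_le_trans dist _.
  by rewrite -[leRHS]mul1e lee_wpmul2r // lee_fin.
exists u, (k' + delta + delta)%R; split=> //.
- split; first by rewrite addr_gt0.
  have <- : (alpha * K = tau)%R by rewrite mulrC divfK // gt_eqF.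
  by rewrite ltr_pM2l // /delta; lra.
- split=> //; rewrite fE -[f u](max_idPl (ltW fu0)).
  apply: le_trans _ (_ : _ <= F%:E); last first.
    by rewrite -fE; exact: ux.
  by rewrite leeDl // lee_fin mulr_ge0 ?mdist_ge0 // ltW.
Qed.

Lemma nonlocal_slope_le f u (c : R) : (0 <= c)%R -> f u \is a fin_num -> 0 < f u ->
  (forall v, maxe (f u) 0 <= maxe (f v) 0 + (c * mdist u v)%:E) ->
  nonlocal_slope f u <= c%:E.
Proof.
move=> c0 fuf fu0 umin; rewrite /nonlocal_slope; case: ifPn => [_|]; last first.
  by rewrite ltey_eq fuf.
rewrite ge_max lee_fin c0 /=; apply: ge_ereal_sup => _ [v /= vu <-].
have d0 : (0 < mdist v u)%R by rewrite mdist_gt0.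
have := umin v; rewrite (max_idPl (ltW fu0)) (metric_sym u v) -(fineK fuf).
have : 0 <= maxe (f v) 0 by rewrite le_max lexx orbT.
case: (maxe (f v) 0) => [y| |] //.
  rewrite !lee_fin => _ h; rewrite -EFinB -EFin_max -EFinM lee_fin ler_pdivrMr //.
  by rewrite ge_max mulr_ge0 ?(ltW d0) //=; lra.
by move=> _ _; rewrite /= (max_idPl (leNye _)) mul0e lee_fin.
Qed.

(** Near u, where f is positive, the difference quotients are among those that
define the nonlocal slope. *)
Lemma slope_le f u (c : R) : lower_semicontinuous f -> (0 <= c)%R -> f u \is a fin_num ->
  0 < f u -> (forall v, maxe (f u) 0 <= maxe (f v) 0 + (c * mdist u v)%:E) ->
  slope f u <= c%:E.
Proof.
move=> lf c0 fuf fu0 umin; rewrite /slope; case: ifPn => [ful|]; last first.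
  by rewrite ltey_eq fuf.
have := nonlocal_slope_le c0 fuf fu0 umin; rewrite /nonlocal_slope ful.
rewrite !ge_max => /andP[_ nl]; rewrite lee_fin c0 /=; apply: le_trans nl.
pose V := [set v | 0 < f v /\ v != u].
apply: (@le_trans _ _ (ereal_sup
    ((fun v => maxe 0 (f u - f v) * ((mdist v u)^-1)%:E) @` V))).
  apply: ereal_inf_lbound; exists V => //.
  have [r r0 rf] := lsc_positive_ball lf fu0.
  apply/nbhs_ballP; exists r => //= v; rewrite ballEmdist /= => uv vu.
  by split=> //; apply: rf.
apply: ge_ereal_sup => _ [v [fv vu] <-].
by apply: ereal_sup_ubound; exists v => //; rewrite (max_idPl (ltW fv)).
Qed.

End error_bound_metric.

(** * Error bounds in normed spaces *)

Section dual_slopes.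
Context (R : realType) (X : normedModType R).
Implicit Types (f : X -> \bar R) (p : {linear X -> R^o}).
Local Open Scope ereal_scope.

Lemma dist0_dual_le (A : set {linear X -> R^o}) p (c : R) : (0 <= c)%R -> A p ->
  (forall z, `|p z : R| <= c * `|z|)%R -> dist0_dual A <= c%:E.
Proof.
move=> c0 Ap pc; apply: (@le_trans _ _ (dual_norm_on setT (p : X -> R))).
  by apply: ereal_inf_lbound; exists p.
apply: ge_ereal_sup => _ [z [_ z1] <-]; rewrite lee_fin; apply: le_trans (pc z) _.
by rewrite ler_piMr.
Qed.

Lemma dual_norm_onT_bound p (n : R) : dual_norm_on setT (p : X -> R) <= n%:E ->
  forall z, (`|p z : R| <= n * `|z|)%R.
Proof.
move=> pn z; have [->|z0] := eqVneq z 0%R; first by rewrite raddf0 !normr0 mulr0.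
have z1 : (0 < `|z|)%R by rewrite normr_gt0.
rewrite -ler_pdivrMr // -lee_fin; apply: le_trans pn.
apply: ereal_sup_ubound; exists (`|z|^-1 *: z)%R.
  by split=> //; rewrite normrZ ger0_norm ?invr_ge0 // mulVf // gt_eqF.
by rewrite linearZ /= normrZ ger0_norm ?invr_ge0 // mulrC.
Qed.

Lemma frechet_subdiff_intro f x p (c : R) : (forall u, f u != -oo) -> f x < +oo ->
  (forall z, `|p z : R| <= c * `|z|)%R ->
  (forall eps : R, (0 < eps)%R -> exists2 s : R, (0 < s)%R &
    forall y : X, (`|y - x| < s)%R ->
      f x + (p (y - x)%R : R)%:E <= f y + (eps * `|y - x|)%:E) ->
  frechet_subdiff f x p.
Proof.
move=> fN fx pc px; split=> //; first exact: linear_continuous_of_bound pc.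
have fxf : f x \is a fin_num by rewrite fin_numE fN -ltey.
rewrite limf_einfE; apply/lee_addgt0Pr => eps eps0; rewrite -leeBlDr // sub0e.
have [s s0 ps] := px _ eps0.
pose V := [set y | (`|y - x| < s)%R /\ y != x].
set h := (X in [set ereal_inf (X @` _) | _ in _]).
apply: (@le_trans _ _ (ereal_inf (h @` V))); last first.
  apply: ereal_sup_ubound; exists V => //.
  apply/nbhs_ballP; exists s => //= v; rewrite -ball_normE /= distrC => vs vx.
  by split.
apply: le_ereal_inf_tmp => _ [y [ys yx] <-]; rewrite /h.
have d0 : (0 < `|y - x|)%R by rewrite normr_gt0 subr_eq0.
have := ps y ys; move: (fN y); rewrite -(fineK fxf); case: (f y) => [r| |] // _.
  rewrite -!EFinD -EFinM !lee_fin ler_pdivlMr //; lra.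
by move=> _; rewrite /= gt0_mulye ?leey // lte_fin invr_gt0.
Qed.

(** On the sublevel set the subgradient inequality reads f x <= p (x - u), so the
norm of p is a rate in the sense of [error_bound_rate]. *)
Lemma error_bound_convex_slope (f : normed_metric X -> \bar R)
    (x : normed_metric X) (tau : R) :
  (forall u, f u != -oo) -> 0 < f x -> (0 < tau)%R ->
  error_bound f tau x -> tau%:E <= convex_subdiff_slope f x.
Proof.
move=> fN fx0 tau0 eb; apply: le_ereal_inf_tmp => _ [p [pcont fx px] <-].
have fxf : f x \is a fin_num by rewrite fin_numE fN -ltey.
rewrite leNgt; apply/negP => lt.
have n0 : 0 <= dual_norm_on setT (p : normed_metric X -> R).
  apply: ereal_sup_ubound; exists 0%R; first by split=> //; rewrite normr0.
  by rewrite raddf0 normr0.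
have nf : dual_norm_on setT (p : normed_metric X -> R) \is a fin_num.
  by rewrite ge0_fin_numE // (lt_trans lt) ?ltry.
pose n := fine (dual_norm_on setT (p : normed_metric X -> R)).
have nE : dual_norm_on setT (p : normed_metric X -> R) = n%:E by rewrite fineK.
have n0' : (0 <= n)%R by rewrite -lee_fin -nE.
have nt : (n < tau)%R by rewrite -lte_fin -nE.
suff : (tau <= (n + tau) / 2)%R by lra.
apply: (error_bound_rate tau0 _ fx0 fx) eb; first lra.
move=> u fu; have := px u; move: fu; rewrite /sublevel0 /= -(fineK fxf).
move: (fN u); case: (f u) => [r| |] // _; rewrite !lee_fin => r0 h.
have pn : dual_norm_on setT (p : normed_metric X -> R) <= n%:E by rewrite nE.
have := dual_norm_onT_bound pn (u - x)%R; have := ler_norm (- p (u - x)%R : R).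
rewrite normrN => a b.
have c : (n * `|u - x| <= (n + tau) / 2 * mdist x u)%R.
  by rewrite (metric_sym x u) ler_wpM2r ?normr_ge0 //; lra.
lra.
Qed.

End dual_slopes.

Section error_bound_banach.
Context (R : realType).
Local Open Scope ereal_scope.

(** The argument common to all slopes Df that are at most c at points where
f_+ + c d(u, .) is minimal. *)
Lemma error_bound_of_slope (X : metricType R) (f : X -> \bar R) (x : X) (tau alpha : R)
    (Df : X -> \bar R) :
  complete_metric X -> lower_semicontinuous f -> 0 < f x -> (0 < tau)%R ->
  (0 < alpha <= 1)%R ->
  (forall u (c : R), (0 < c)%R -> f u \is a fin_num -> 0 < f u ->
    (forall v, maxe (f u) 0 <= maxe (f v) 0 + (c * mdist u v)%:E) -> Df u <= c%:E) ->
  (forall u : X,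
     f u <= f x ->
     (mdist u x)%:E < alpha%:E * dist_set x (sublevel0 f) ->
     alpha%:E * f u < tau%:E * dist_set u (sublevel0 f) ->
     f u < tau%:E * dist_set x (sublevel0 f) ->
     tau%:E <= alpha%:E * Df u) ->
  error_bound f tau x.
Proof.
move=> cX lf fx0 tau0 a01 Dfc h; have /andP[a0 a1] := a01.
apply: contrapT => neb.
have [u [c [[c0 ac] ltx [ux fu0] dux umin]]] :=
  error_bound_failure cX lf fx0 tau0 a01 neb.
have fuf : f u \is a fin_num.
  rewrite fin_real // (lt_trans _ fu0) ?ltNyr //=.
  by apply: le_lt_trans ux _; apply: lt_le_trans ltx (leey _).
have [r r0 rf] := lsc_positive_ball lf fu0.
have cond3 : alpha%:E * f u < tau%:E * dist_set u (sublevel0 f).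
  apply: (@lt_dist_sublevel _ _ _ _ _ _ (alpha * c)%R r) => //.
  - by rewrite mulr_gt0.
  - move=> v fv; have := umin v; rewrite (max_idPl (ltW fu0)) (max_idPr fv) add0e.
    by move=> /(lee_wpmul2l (ltW (a0 : 0 < alpha%:E))); rewrite -EFinM mulrA.
  - move=> v; rewrite /sublevel0 /= leNgt => /negP fv; rewrite leNgt; apply/negP.
    by move=> /rf.
have := h u ux dux cond3 (le_lt_trans ux ltx).
rewrite leNgt => /negP; apply.
apply: le_lt_trans (_ : alpha%:E * c%:E < _); last by rewrite -EFinM lte_fin.
by rewrite lee_wpmul2l ?lee_fin ?(ltW a0) //; exact: Dfc.
Qed.

Lemma clarke_slope_le (X : normedModType R) (f : normed_metric X -> \bar R)
    (u : normed_metric X) (c : R) : (forall v, f v != -oo) -> lower_semicontinuous f ->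
  (0 < c)%R -> f u \is a fin_num -> 0 < f u ->
  (forall v, maxe (f u) 0 <= maxe (f v) 0 + (c * mdist u v)%:E) ->
  @clarke_slope R X f u <= c%:E.
Proof.
move=> fN lf c0 fuf fu0 umin.
have [r r0 rf] := lsc_positive_ball lf fu0.
have [||p pC pc] := @clarke_subgradient_of_min R X f u c fN (ltW c0).
- by rewrite ltey_eq fuf.
- exists r => // v vr; have := umin v.
  have fv : 0 <= f v by apply/ltW/rf; rewrite metric_sym.
  by rewrite (max_idPl (ltW fu0)) (max_idPl fv) metric_sym.
exact: (dist0_dual_le (ltW c0) pC pc).
Qed.

(** Unlike in [error_bound_of_slope], the slope is evaluated at a point u near the
point w given by Ekeland.  The radius rho is chosen so small that the
conditions satisfied by w persist at u; f u may exceed f w, hence f x, which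
is why mu is needed. *)
Lemma error_bound_of_frechet_slope (X : completeNormedModType R)
    (f : normed_metric X -> \bar R) (x : normed_metric X) (tau alpha mu : R) :
  (forall u, f u != -oo) -> 0 < f x -> (0 < tau)%R -> lower_semicontinuous f ->
  (0 < alpha <= 1)%R -> asplund X -> f x < mu%:E ->
  (forall u : normed_metric X,
     f u < mu%:E ->
     (mdist u x)%:E < alpha%:E * dist_set x (sublevel0 f) ->
     alpha%:E * f u < tau%:E * dist_set u (sublevel0 f) ->
     f u < tau%:E * dist_set x (sublevel0 f) ->
     tau%:E <= alpha%:E * frechet_slope f u) ->
  error_bound f tau x.
Proof.
move=> fN fx0 tau0 lf a01 aX fmu h; have /andP[a0 a1] := a01.
apply: contrapT => neb.
have [w [c [[c0 ac] ltx [wx fw0] dwx wmin]]] :=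
  error_bound_failure (@banach_complete_metric R X) lf fx0 tau0 a01 neb.
set D := dist_set x _ in h ltx dwx.
have fwf : f w \is a fin_num.
  rewrite fin_real // (lt_trans _ fw0) ?ltNyr //=.
  by apply: le_lt_trans wx _; apply: lt_le_trans ltx (leey _).
set W := fine (f w).
have wE : f w = W%:E by rewrite fineK.
have [r r0 rf] := lsc_positive_ball lf fw0.
have [m1 m1w m1D] := ereal_between dwx.
have [m2 m2w m2D] : exists2 b : R, (W < b)%R & b%:E < tau%:E * D.
  by apply: ereal_between; rewrite -wE; exact: le_lt_trans ltx.
have muw : (W < mu)%R by rewrite -lte_fin -wE; exact: le_lt_trans fmu.
pose sigma := ((alpha * c + tau) / 2)%R.
have ac0 : (0 < alpha * c)%R by rewrite mulr_gt0.
(* The bound on rho for which the estimate alpha f w <= alpha c d(w, v) becomes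
   alpha f u <= sigma d(u, v), when d(u, v) >= r / 2. *)
have sg0 : (0 < (sigma - alpha * c) * (r / 2) / (alpha * (c + 1)))%R.
  apply: divr_gt0; last by rewrite mulr_gt0 // addr_gt0.
  by rewrite mulr_gt0 ?divr_gt0 // /sigma; lra.
have [rho rho0 rhoP] : exists2 rho : R, (0 < rho)%R &
    [/\ rho <= r / 2, rho <= m1 - mdist w x, rho <= m2 - W, rho <= mu - W &
      rho <= (sigma - alpha * c) * (r / 2) / (alpha * (c + 1))]%R.
  have [|rho rho0 rhoP] := @seq_lower_bound R R [:: r / 2; m1 - mdist w x; m2 - W; mu - W;
      (sigma - alpha * c) * (r / 2) / (alpha * (c + 1))]%R id.
    move=> a; rewrite !inE => /or4P[/eqP->|/eqP->|/eqP->|/orP[/eqP->|/eqP->]] //=;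
      by rewrite ?subr_gt0 ?divr_gt0.
  by exists rho => //; split; apply: rhoP; rewrite !inE eqxx ?orbT.
have [rr rm1 rm2 rmu rsg] := rhoP.
pose K := (tau / alpha)%R; pose c2 := ((c + K) / 2)%R.
have cK : (c < K)%R by rewrite ltr_pdivlMr // mulrC.
have aK : (alpha * K = tau)%R by rewrite mulrC divfK // gt_eqF.
have gw : maxe (f w) 0 = f w by rewrite (max_idPl (ltW fw0)).
have [u [p [duw gu pc pu]]] : exists (u : normed_metric X) (p : {linear X -> R^o}),
    [/\ (mdist u w < rho)%R, maxe (f u) 0 < maxe (f w) 0 + rho%:E,
      forall z, (`|p z : R| <= c2 * `|z|)%R &
      forall eps : R, (0 < eps)%R -> exists2 s : R, (0 < s)%R &
        forall y : X, (`|y - u| < s)%R ->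
          maxe (f u) 0 + (p (y - u)%R : R)%:E <= maxe (f y) 0 + (eps * `|y - u|)%:E].
  apply: (@asplund_fuzzy R X (fun v => maxe (f v) 0) w c c2 rho aX (lsc_max0 lf)).
  - by move=> v; rewrite le_max lexx orbT.
  - by rewrite gw ltey_eq fwf.
  - exact: ltW.
  - by rewrite /c2; lra.
  - by [].
  - by move=> v; have := wmin v; rewrite metric_sym.
have wu v : (mdist w v <= mdist w u + mdist u v)%R by exact: metric_triangle.
have pos v : (mdist u v < r / 2)%R -> 0 < f v.
  move=> uv; apply: rf; have := wu v; rewrite (metric_sym w u); lra.
have fu0 : 0 < f u by apply: pos; rewrite mdistxx divr_gt0.
rewrite gw (max_idPl (ltW fu0)) wE -EFinD in gu.
have fuf : f u \is a fin_num.
  by rewrite fin_real // (lt_trans _ fu0) ?ltNyr //= (lt_trans gu) ?ltry.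
have uE : f u = (fine (f u))%:E by rewrite fineK.
have Uw : (fine (f u) < W + rho)%R by rewrite -lte_fin -uE.
have c20 : (0 <= c2)%R by rewrite /c2; lra.
have slope_u : frechet_slope f u <= c2%:E.
  apply: (@dist0_dual_le R (normed_metric X) _ p c2 c20 _ pc).
  apply: (@frechet_subdiff_intro R (normed_metric X) f u p c2 fN _ pc).
    by rewrite ltey_eq fuf.
  move=> eps eps0; have [s s0 ps] := pu _ eps0.
  exists (Num.min s (r / 2))%R; first by rewrite lt_min s0 divr_gt0.
  move=> y; rewrite lt_min => /andP[ys yr].
  have fy : 0 <= f y by apply/ltW/pos; rewrite metric_sym.
  by have := ps y ys; rewrite (max_idPl (ltW fu0)) (max_idPl fy).
suff : tau%:E <= alpha%:E * frechet_slope f u.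
  rewrite leNgt => /negP; apply.
  apply: (@le_lt_trans _ _ (alpha%:E * c2%:E)).
    by rewrite lee_wpmul2l // lee_fin ltW.
  by rewrite -EFinM lte_fin -aK ltr_pM2l // /c2; lra.
apply: h.
- by rewrite uE lte_fin; lra.
- apply: lt_trans m1D; rewrite lte_fin.
  by have := metric_triangle u w x; lra.
- apply: (@lt_dist_sublevel _ _ _ _ _ _ sigma (r / 2)%R) => //.
  + by rewrite /sigma; apply/andP; split; lra.
  + by rewrite divr_gt0.
  + move=> v fv; have fv' := wmin v.
    rewrite gw (max_idPr fv) add0e wE lee_fin in fv'.
    have rv : (r / 2 <= mdist u v)%R.
      by rewrite leNgt; apply/negP => /pos; rewrite ltNge fv.
    rewrite uE -EFinM lee_fin.
    have a1' : (alpha * fine (f u) <= alpha * (c * (rho + mdist u v) + rho))%R.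
      rewrite ler_pM2l //; have := wu v; rewrite (metric_sym w u) => wuv.
      have : (c * mdist w v <= c * (rho + mdist u v))%R.
        by rewrite ler_pM2l //; lra.
      lra.
    have a2' : (rho * (alpha * (c + 1)) <= (sigma - alpha * c) * (r / 2))%R.
      by rewrite -ler_pdivlMr // mulr_gt0 // addr_gt0.
    have a3' : ((sigma - alpha * c) * (r / 2) <= (sigma - alpha * c) * mdist u v)%R.
      by rewrite ler_wpM2l // /sigma; lra.
    lra.
  + move=> v fv; rewrite leNgt; apply/negP => /pos; rewrite ltNge.
    by move: fv; rewrite /sublevel0 /= => ->.
- by apply: lt_trans m2D; rewrite uE lte_fin; lra.
Qed.

End error_bound_banach.

Local Open Scope ereal_scope.
Theorem proposition3p1 (R : realType) :
  (forall (X : metricType R) (f : X -> \bar R) (x : X) (tau : R),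
     (forall u, f u != -oo) -> 0 < f x -> (0 < tau)%R ->
     complete_metric X -> lower_semicontinuous f ->
     forall alpha : R, (0 < alpha <= 1)%R ->
     forall Df : X -> \bar R, metric_slopes f Df ->
     (forall u : X,
        f u <= f x ->
        (mdist u x)%:E < alpha%:E * dist_set x (sublevel0 f) ->
        alpha%:E * f u < tau%:E * dist_set u (sublevel0 f) ->
        f u < tau%:E * dist_set x (sublevel0 f) ->
        tau%:E <= alpha%:E * Df u) ->
     error_bound f tau x) /\
  (forall (X : completeNormedModType R) (f : normed_metric X -> \bar R)
     (x : normed_metric X) (tau : R),
     (forall u, f u != -oo) -> 0 < f x -> (0 < tau)%R ->
     lower_semicontinuous f ->
     forall alpha : R, (0 < alpha <= 1)%R ->
     forall Df : normed_metric X -> \bar R, banach_slopes f Df ->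
     (forall u : normed_metric X,
        f u <= f x ->
        (mdist u x)%:E < alpha%:E * dist_set x (sublevel0 f) ->
        alpha%:E * f u < tau%:E * dist_set u (sublevel0 f) ->
        f u < tau%:E * dist_set x (sublevel0 f) ->
        tau%:E <= alpha%:E * Df u) ->
     error_bound f tau x) /\
  (forall (X : completeNormedModType R) (f : normed_metric X -> \bar R)
     (x : normed_metric X) (tau : R),
     (forall u, f u != -oo) -> 0 < f x -> (0 < tau)%R ->
     lower_semicontinuous f ->
     forall alpha : R, (0 < alpha <= 1)%R ->
     asplund X ->
     (exists mu : R, f x < mu%:E /\
       forall u : normed_metric X,
         f u < mu%:E ->
         (mdist u x)%:E < alpha%:E * dist_set x (sublevel0 f) ->
         alpha%:E * f u < tau%:E * dist_set u (sublevel0 f) ->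
         f u < tau%:E * dist_set x (sublevel0 f) ->
         tau%:E <= alpha%:E * frechet_slope f u) ->
     error_bound f tau x) /\
  (forall (X : metricType R) (f : X -> \bar R) (x : X) (tau : R),
     (forall u, f u != -oo) -> 0 < f x -> (0 < tau)%R ->
     error_bound f tau x -> tau%:E <= nonlocal_slope f x) /\
  (forall (X : normedModType R) (f : normed_metric X -> \bar R)
     (x : normed_metric X) (tau : R),
     (forall u, f u != -oo) -> 0 < f x -> (0 < tau)%R ->
     convex_efun f ->
     error_bound f tau x -> tau%:E <= convex_subdiff_slope f x).
Proof.
split; [|split; [|split; [|split]]].
- move=> X f x tau fN fx0 tau0 cX lf alpha a01 Df Dfs h.
  apply: (error_bound_of_slope cX lf fx0 tau0 a01 _ h) => u c c0 fuf fu0 umin.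
  case: Dfs => ->; first exact: nonlocal_slope_le (ltW c0) _ _ _.
  exact: slope_le (ltW c0) _ _ _.
- move=> X f x tau fN fx0 tau0 lf alpha a01 Df Dfs h.
  apply: (error_bound_of_slope (@banach_complete_metric R X) lf fx0 tau0 a01 _ h).
  move=> u c c0 fuf fu0 umin.
  case: Dfs => [[->|->]|->]; first exact: nonlocal_slope_le (ltW c0) _ _ _.
    exact: slope_le (ltW c0) _ _ _.
  exact: clarke_slope_le.
- move=> X f x tau fN fx0 tau0 lf alpha a01 aX [mu [fmu h]].
  exact: (error_bound_of_frechet_slope fN fx0 tau0 lf a01 aX fmu h).
- move=> X f x tau _ fx0 tau0; exact: error_bound_nonlocal_slope.
- move=> X f x tau fN fx0 tau0 _; exact: error_bound_convex_slope.
Qed.
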